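(* If $t\in[0,1]\mapsto D_t$ is a $C^1_\Gamma$-path of self-adjoint linear operators on a Hilbert space $\mathcal H$, then $t\in[0,1]\mapsto\vartheta(D_t)$ is a $C^1$-path with respect to the operator norm, where $\vartheta(x)=\dfrac{x}{(1+x^2)^{1/2}}$.
   Context: A path $t\in[0,1]\mapsto D_t$ of (possibly unbounded) self-adjoint operators on $\mathcal H$ is $\Gamma$-differentiable at $t_0$ if there is a bounded operator $T$ with $\lim_{t\to t_0}\big\|\frac{D_t-D_{t_0}}{t-t_0}(1+D_{t_0}^2)^{-1/2}-T\big\|=0$ (in particular $\mathrm{dom}(D_{t_0})\subseteq\mathrm{dom}(D_t)$ for $t$ near $t_0$); then $\dot D_{t_0}:=T(1+D_{t_0}^2)^{1/2}$, a symmetric operator on $\mathrm{dom}(D_{t_0})$. The path is continuously $\Gamma$-differentiable, or a $C^1_\Gamma$-path, if $t\mapsto\dot D_t(1+D_t^2)^{-1/2}$ is defined and continuous in operator norm on $[0,1]$. *)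

(* Defs.v *)
From HB Require Import structures.
From mathcomp Require Import all_boot all_order all_algebra.
From mathcomp Require Export complex.
From mathcomp Require Export all_classical all_reals all_analysis.

Set Implicit Arguments.
Unset Strict Implicit.
Unset Printing Implicit Defensive.

Import Order.TTheory GRing.Theory Num.Theory.
Import numFieldNormedType.Exports.

Local Open Scope classical_set_scope.
Local Open Scope ring_scope.
Local Open Scope complex_scope.

(* A complex Hilbert space is a complete normed module H over R[i] with an
   inner product ip, linear in its first argument, that induces the norm.  *)
Definition induces_norm (R : realType) (H : completeNormedModType R[i])
    (ip : {dot H for Num.conj}) : Prop :=
  forall x : H, `|x| ^+ 2 = ip x x.

(* Only the values of [app] on [dom] are meaningful. *)
Record unbounded_op (R : realType) (H : completeNormedModType R[i]) :=
  UnboundedOp {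
    dom : set H;
    app :> H -> H;
    dom0 : dom 0;
    dom_linear : forall (a : R[i]) (x y : H),
      dom x -> dom y -> dom (a *: x + y);
    app_linear : forall (a : R[i]) (x y : H),
      dom x -> dom y -> app (a *: x + y) = a *: app x + app y }.

Section SelfAdjoint.
Variables (R : realType) (H : completeNormedModType R[i]).
Variable ip : {dot H for Num.conj}.
Implicit Type D : unbounded_op H.

Definition graph D : set (H * H) := [set p | dom D p.1 /\ p.2 = D p.1].

Definition adjoint_graph D : set (H * H) :=
  [set p | forall x, dom D x -> ip (D x) p.1 = ip x p.2].

Definition self_adjoint D : Prop :=
  dense (dom D) /\ adjoint_graph D = graph D.

Definition bounded_op (T : H -> H) : Prop :=
  linear T /\ exists M : R, forall x, `|T x| <= M%:C * `|x|.

(* [`|y|] is an element of R[i] with zero imaginary part. *)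
Definition opnorm (T : H -> H) : \bar R :=
  ereal_sup [set (complex.Re `|T x|)%:E | x in [set x | `|x| <= 1]].

Definition dom_sq D : set H := [set x | dom D x /\ dom D (D x)].

(* B is a positive bounded operator whose square is the inverse of the
   operator 1 + D^2 with domain dom(D^2). *)
Definition is_inv_sqrt_1sq D (B : H -> H) : Prop :=
  [/\ bounded_op B,
      (forall x, 0 <= ip (B x) x),
      (forall x, dom_sq D (B (B x)) /\
                 B (B x) + D (D (B (B x))) = x) &
      (forall x, dom_sq D x -> B (B (x + D (D x))) = x)].

(* (1 + D^2)^(-1/2): such a B exists and is unique when D is self-adjoint,
   so [get] selects the functional-calculus operator. *)
Definition inv_sqrt_1sq D : H -> H := get (is_inv_sqrt_1sq D).

(* (1 + D^2)^(1/2), the inverse of (1 + D^2)^(-1/2), with domain its range *)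
Definition sqrt_1sq D : H -> H :=
  fun x => get [set y | inv_sqrt_1sq D y = x].

(* vartheta(D) for vartheta(x) = x / (1 + x^2)^(1/2) *)
Definition vartheta D : H -> H := D \o inv_sqrt_1sq D.

End SelfAdjoint.

Section Paths.
Variables (R : realType) (H : completeNormedModType R[i]).
Variable ip : {dot H for Num.conj}.

(* Paths are parametrised by [0,1]; values outside are irrelevant, and all
   limits are taken within [0,1], hence one-sided at the end points. *)
Local Notation I := (`[0, 1]%classic : set R).

(* The convergence to 0 of the extended-real valued [opnorm] contains the
   boundedness of the difference quotient for t near t0. *)
Definition is_Gamma_diff (D : R -> unbounded_op H) (t0 : R) (T : H -> H)
    : Prop :=
  [/\ bounded_op T,
      (\forall t \near within I t0^', dom (D t0) `<=` dom (D t)) &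
      opnorm (fun x => let y := inv_sqrt_1sq ip (D t0) x in
                ((t - t0)^-1)%:C *: (D t y - D t0 y) - T x)
        @[t --> within I t0^'] --> 0%E].

Definition Gamma_differentiable (D : R -> unbounded_op H) (t0 : R) : Prop :=
  exists T, is_Gamma_diff D t0 T.

(* The operator T (1 + D_t0^2)^(1/2), with domain dom(D_t0). *)
Definition Gamma_deriv (D : R -> unbounded_op H) (t0 : R) : H -> H :=
  get (is_Gamma_diff D t0) \o sqrt_1sq ip (D t0).

Definition norm_continuous (F : R -> H -> H) : Prop :=
  forall t0, I t0 ->
    opnorm (fun x => F t x - F t0 x) @[t --> within I (nbhs t0)] --> 0%E.

Definition C1_Gamma_path (D : R -> unbounded_op H) : Prop :=
  (forall t, I t -> Gamma_differentiable D t) /\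
  norm_continuous (fun t => Gamma_deriv D t \o inv_sqrt_1sq ip (D t)).

Definition norm_derivative (F : R -> H -> H) (t0 : R) (F' : H -> H) : Prop :=
  opnorm (fun x => ((t - t0)^-1)%:C *: (F t x - F t0 x) - F' x)
    @[t --> within I t0^'] --> 0%E.

Definition norm_C1_path (F : R -> H -> H) : Prop :=
  (forall t, I t -> bounded_op (F t)) /\
  exists F' : R -> H -> H,
    [/\ forall t, I t -> bounded_op (F' t),
        forall t, I t -> norm_derivative F t (F' t) &
        norm_continuous F'].

End Paths.

(* Main.v *)
Require Import Defs.
From mathcomp Require Import all_boot all_order all_algebra.
From mathcomp Require Import ring lra.
Import Order.TTheory GRing.Theory Num.Theory.
Import numFieldNormedType.Exports.
Local Open Scope classical_set_scope.
Local Open Scope ring_scope.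
Local Open Scope complex_scope.

(* Write S = (1 + D^2)^(1/2), B = S^-1, F = D B, and q for the quadratic form
   of S on W = dom D. For D1, D2 near each other (hence with the same domain)
   and V = D1 - D2, the difference of bounded transforms solves the Sylvester
   equation
     S1 (F1 - F2) + (F1 - F2) S2 = V + B1 V B2 - F1 V F2.
   The right-hand side is bounded only as a form relative to q: a symmetric
   operator E with E B bounded is form-bounded by q with the same constant
   (Krein, Heinz), which also makes S and D' = lim V / (t - s) continuous as
   forms, although S B2 need not be continuous in norm. Difference quotients X
   of F are bounded for q, so up to a small form they all solve the same
   equation S0 X + X S0 = Y0, and a Lyapunov argument (A is nonnegative when
   S0 A + A S0 is) turns the closeness of the forms into closeness in operator
   norm: the quotients (F_s - F_t) / (s - t) are uniformly Cauchy near t0. *)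

(** The derivative of F solves a Lyapunov equation whose source is known only as a form, so it is
    never written down. It is obtained from a Cauchy estimate between quotients based at two points
    near t0: equal base points give its existence, different ones its continuity.

    How close s must be to t for a quotient to enter the estimate depends on t, because the
    convergence that defines the derivative at t carries no rate uniform in t. The radius for s is
    therefore chosen after t.

    Of the functional calculus of D only one square root is constructed, by iteration. The rest is
    algebra with [B^2 + D^2 B^2 = 1], [S F = D] and [S = B + D F], the last two on the domain. Forms
    are taken with the real part of the inner product; the complex structure comes back only by
    testing against ['i *: x]. *)

Set Implicit Arguments.
Unset Strict Implicit.
Unset Printing Implicit Defensive.

(** * The underlying real Hilbert space *)

Section RealStructure.
Variables (R : realType) (H : completeNormedModType R[i]).

(** The norm takes values in [R[i]], whose order is partial; all estimates are made on its real
    part. *)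
Definition nr (x : H) : R := complex.Re `|x|.

Lemma nrE x : `|x| = (nr x)%:C.
Proof.
have := normr_ge0 x; rewrite /nr; case: `|x| => a b.
by rewrite lecE /= => /andP[/eqP -> _].
Qed.

Lemma nr_ge0 x : 0 <= nr x.
Proof. by have := normr_ge0 x; rewrite nrE lecR. Qed.

Lemma nr0 : nr 0 = 0.
Proof. by rewrite /nr normr0. Qed.

Lemma nr0_eq0 x : nr x = 0 -> x = 0.
Proof. by move=> h; apply/eqP; rewrite -normr_eq0 nrE h. Qed.

Lemma nrD x y : nr (x + y) <= nr x + nr y.
Proof. by have := ler_normD x y; rewrite !nrE -rmorphD lecR. Qed.

Lemma nrN x : nr (- x) = nr x.
Proof. by rewrite /nr normrN. Qed.

Lemma nrB x y : nr (x - y) = nr (y - x).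
Proof. by rewrite /nr distrC. Qed.

Lemma nrZ (a : R) x : nr (a%:C *: x) = `|a| * nr x.
Proof.
have : `|a%:C *: x| = (`|a| * nr x)%:C.
  by rewrite normrZ nrE rmorphM /= normc_def /= expr0n /= addr0 sqrtr_sqr.
by rewrite nrE => -[].
Qed.

Lemma nr_tri x y z : nr (x - z) <= nr (x - y) + nr (y - z).
Proof. by have := nrD (x - y) (y - z); rewrite addrA subrK. Qed.

Lemma nr_cauchy (u : nat -> H) :
  (forall e : R, 0 < e -> exists N, forall m n, (N <= m)%N -> (N <= n)%N ->
     nr (u m - u n) < e) ->
  exists l, forall e : R, 0 < e -> exists N, forall n, (N <= n)%N -> nr (u n - l) < e.
Proof.
move=> hu.
have : cvgn u.
  apply/cauchy_cvgP/cauchy_ballP => e e0.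
  have [r er r0] : exists2 r : R, e = r%:C & 0 < r.
    move: e0; case: e => a b; rewrite ltcE /= => /andP[/eqP -> a0].
    by exists a.
  have [N hN] := hu _ r0.
  exists (u @` [set n | (N <= n)%N], u @` [set n | (N <= n)%N]) => /=.
    by split; exists N => // n /= Nn; exists n.
  move=> [x y] /= [[m Nm <-] [n Nn <-]].
  by rewrite -ball_normE /ball_ /= nrE er ltcR hN.
move=> h; exists (limn u).
move=> e e0; move/cvgrPdist_lt : h => /(_ (e%:C)).
rewrite ltcR => /(_ e0) [N _ hN]; exists N => n Nn.
by have := hN _ Nn; rewrite /= distrC nrE ltcR.
Qed.

End RealStructure.

(** * Growth rates and discriminants *)

Section RealLemmas.
Variable R : realType.

Lemma bernoulli_ineq (h : R) n : 0 <= h -> 1 + n%:R * h <= (1 + h) ^+ n.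
Proof.
move=> h0; elim: n => [|n IH]; first by rewrite mul0r addr0 expr0.
have n0 : 0 <= n%:R :> R by [].
rewrite exprS -natr1.
apply: (@le_trans _ _ ((1 + h) * (1 + n%:R * h))); first nra.
by rewrite ler_wpM2l //; lra.
Qed.

(** If [b > k > 0], Bernoulli's inequality makes [(b / k) ^+ n] exceed [c / a]. *)
Lemma geometric_bound_le (a b c k : R) : 0 <= k -> 0 < a -> 0 <= b ->
  (forall n, a * b ^+ n <= c * k ^+ n) -> b <= k.
Proof.
move=> k0 a0 b0 h; rewrite leNgt; apply/negP => kb.
have [k00|kn0] := eqVneq k 0.
  have := h 1%N; rewrite !expr1 k00 mulr0; nra.
have kp : 0 < k by rewrite lt_def kn0.
pose d := b / k - 1.
have d0 : 0 < d by rewrite subr_gt0 ltr_pdivlMr ?mul1r.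
have := archi_boundP (ltW (divr_gt0 (ltr_pwDl ltr01 (normr_ge0 (c / a))) d0)).
set n := Num.bound _ => hn.
have := h n; rewrite -ler_pdivrMr ?exprn_gt0 // -mulrA -expr_div_n.
have -> : b / k = 1 + d by rewrite /d addrC subrK.
move=> hc; have := bernoulli_ineq n (ltW d0).
move: hn; rewrite ltr_pdivrMr // => hn.
have : (1 + d) ^+ n <= c / a by rewrite ler_pdivlMr // mulrC.
have := ler_norm (c / a); lra.
Qed.

Lemma inv_natS_lt (e : R) : 0 < e ->
  exists N, forall n, (N <= n)%N -> n.+1%:R^-1 < e.
Proof.
move=> e0; have ei : 0 <= e^-1 by rewrite invr_ge0 ltW.
exists (Num.bound e^-1) => n Nn; rewrite invf_plt ?posrE //.
by apply: lt_le_trans (archi_boundP ei) _; rewrite ler_nat ltnW.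
Qed.

(** Log-convexity makes the ratios [m n.+1 / m n] nondecreasing, so [m] grows at least like the
    powers of its first ratio, which the geometric bound then keeps below [k]. *)
Lemma logconvex_le (m : nat -> R) (c k : R) : 0 <= k ->
  (forall n, 0 <= m n) -> (forall n, m n.+1 ^+ 2 <= m n * m n.+2) ->
  (forall n, m n <= c * k ^+ n) -> m 1%N <= k * m 0%N.
Proof.
move=> k0 m0 mc mk.
have [m00|m0n] := eqVneq (m 0%N) 0.
  by have := mc 0%N; have := m0 1%N; rewrite m00; nra.
have m0p : 0 < m 0%N by rewrite lt_def m0n m0.
have [m10|m1n] := eqVneq (m 1%N) 0; first by rewrite m10 mulr_ge0.
have m1p : 0 < m 1%N by rewrite lt_def m1n m0.
pose r := m 1%N / m 0%N.
have r0 : 0 < r by rewrite divr_gt0.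
have H n : 0 < m n /\ r * m n <= m n.+1.
  elim: n => [|n [p1 p2]]; first by rewrite /r divfK.
  have p3 : 0 < m n.+1 by apply: lt_le_trans p2; rewrite mulr_gt0.
  split=> //; rewrite -(ler_pM2l p1); apply: le_trans (mc n); nra.
rewrite -ler_pdivrMr //; apply: (@geometric_bound_le (m 0%N) r c k) => //; first exact: ltW.
move=> n; apply: le_trans (mk n); elim: n => [|n IH]; first by rewrite expr0 mulr1.
by rewrite exprSr mulrA mulrC; apply: le_trans (H n).2; rewrite ler_pM2l.
Qed.

(** The quadratic [c - 2 a b + a^2 d] in [a] is nonnegative; evaluate it at its minimum
    [a = b / d]. *)
Lemma discr_le (b c d : R) : 0 <= c -> 0 <= d ->
  (forall a : R, 2 * a * b <= c + a ^+ 2 * d) -> b ^+ 2 <= c * d.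
Proof.
move=> c0 d0 h.
have [dz|dn] := eqVneq d 0.
  have [-> | bn] := eqVneq b 0; first by rewrite expr0n mulr_ge0.
  (* With [d = 0] the hypothesis is linear in [a], and this value makes its left side
     [2 (c + 1) > c]. *)
  have := h ((c + 1) / b); rewrite dz mulr0 addr0.
  have -> : 2 * ((c + 1) / b) * b = 2 * (c + 1) by field.
  lra.
have dp : 0 < d by rewrite lt_def dn.
have := h (b / d); rewrite expr_div_n.
rewrite -(ler_pM2r dp) => {}h.
have e1 : 2 * (b / d) * b * d = 2 * b ^+ 2 by field.
have e2 : (c + b ^+ 2 / d ^+ 2 * d) * d = c * d + b ^+ 2 by field.
by move: h; rewrite e1 e2; lra.
Qed.

Lemma le_sqrtM (b c d : R) : 0 <= c -> 0 <= d -> b ^+ 2 <= c * d ->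
  `|b| <= Num.sqrt c * Num.sqrt d.
Proof.
move=> c0 d0 h; rewrite -sqrtrM // -sqrtr_sqr; exact: ler_wsqrtr.
Qed.
End RealLemmas.

(** * Symmetric real forms, Cauchy-Schwarz and Krein's lemma *)

Section Forms.
Variables (R : realType) (H : completeNormedModType R[i]).
Implicit Types (W : set H) (b e q : H -> H -> R).

Definition linset W := forall (a : R) x y, W x -> W y -> W (a%:C *: x + y).

Definition symform W b :=
  (forall a x y z, W x -> W y -> W z -> b (a%:C *: x + y) z = a * b x z + b y z) /\
  (forall x y, W x -> W y -> b x y = b y x).

(** Polarisation without loss of constant: subtract the diagonal bounds at [x + a z] and [x - a z],
    use the parallelogram identity for [q], and optimise over [a]. *)
Lemma form_bound W e q k : linset W -> symform W e -> symform W q -> 0 <= k ->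
  (forall x, W x -> 0 <= q x x) ->
  (forall x, W x -> `|e x x| <= k * q x x) ->
  forall x z, W x -> W z ->
  `|e x z| <= k * Num.sqrt (q x x) * Num.sqrt (q z z).
Proof.
move=> lW [el es] [ql qs] k0 q0 he x z Wx Wz.
have ex b a : symform W b -> b (a%:C *: z + x) (a%:C *: z + x) =
    a ^+ 2 * b z z + 2 * a * b x z + b x x.
  move=> [bl bs]; have Waz : W (a%:C *: z + x) by apply: lW.
  rewrite bl // !(bs _ (a%:C *: z + x)) // !bl // (bs z x) //; ring.
have key (a : R) : 2 * a * e x z <= k * q x x + a ^+ 2 * (k * q z z).
  have h1 := he _ (lW a _ _ Wz Wx); have h2 := he _ (lW (- a) _ _ Wz Wx).
  move: h1 h2; rewrite !ex // !ler_norml => /andP[_ h1] /andP[h2 _]; nra.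
have h := discr_le (mulr_ge0 k0 (q0 _ Wx)) (mulr_ge0 k0 (q0 _ Wz)) key.
apply: le_trans (le_sqrtM _ _ h) _; rewrite ?mulr_ge0 ?q0 //.
by rewrite !sqrtrM // mulrACA -expr2 sqr_sqrtr // mulrA.
Qed.

Lemma form_cs W q : linset W -> symform W q -> (forall x, W x -> 0 <= q x x) ->
  forall x z, W x -> W z -> `|q x z| <= Num.sqrt (q x x) * Num.sqrt (q z z).
Proof.
move=> lW sq q0 x z Wx Wz; rewrite -[X in X * _]mul1r.
by apply: (form_bound lW sq sq) => // y Wy; rewrite mul1r ger0_norm ?q0.
Qed.

Lemma form_cs2 W q : linset W -> symform W q -> (forall x, W x -> 0 <= q x x) ->
  forall x z, W x -> W z -> q x z ^+ 2 <= q x x * q z z.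
Proof.
move=> lW sq q0 x z Wx Wz; have h := form_cs lW sq q0 Wx Wz.
rewrite -[q x z ^+ 2]real_normK ?num_real //.
rewrite -[X in X * _]sqr_sqrtr ?q0 // -[X in _ * X]sqr_sqrtr ?q0 // -exprMn.
by rewrite lerXn2r // nnegrE ?mulr_ge0 ?sqrtr_ge0.
Qed.

(* The numbers [b (K^n x) (K^n x)] are log-convex in n, so their first ratio is
   at most their exponential growth rate, which N controls. *)
Lemma krein W b (N : H -> R) (K : H -> H) k : linset W -> symform W b ->
  (forall x, W x -> 0 <= b x x) -> (forall x, W x -> W (K x)) ->
  (forall x y, W x -> W y -> b (K x) y = b x (K y)) ->
  (forall x, W x -> b x x <= N x) -> 0 <= k ->
  (forall x, W x -> N (K x) <= k * N x) ->
  forall x, W x -> b (K x) (K x) <= k * b x x.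
Proof.
move=> lW sb b0 WK bK bN k0 NK x Wx.
have WKn n : W (iter n K x) by elim: n => //= n; exact: WK.
apply: (@logconvex_le _ (fun n => b (iter n K x) (iter n K x)) (N x)) => //.
- by move=> n; exact: b0.
- move=> n; have -> : b (iter n.+1 K x) (iter n.+1 K x) = b (iter n K x) (iter n.+2 K x).
    by rewrite /= bK //; have := WKn n.+1.
  exact: (form_cs2 lW).
- move=> n; apply: le_trans (bN _ (WKn n)) _.
  elim: n => [|n IH]; first by rewrite expr0 mulr1.
  by rewrite /=; apply: le_trans (NK _ (WKn n)) _; rewrite exprS mulrCA ler_wpM2l.
Qed.
End Forms.

(** * The real part of the inner product *)

Section InnerProduct.
Variables (R : realType) (H : completeNormedModType R[i]).
Variables (ip : {dot H for Num.conj}).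
Hypothesis ipN : induces_norm ip.

Definition rip x y : R := complex.Re (ip x y).

Lemma ReZ (a : R) (z : R[i]) : complex.Re (a%:C * z) = a * complex.Re z.
Proof. by case: z => u v /=; rewrite mul0r subr0. Qed.

Lemma ipC x y : ip x y = (ip y x)^*%C.
Proof. by rewrite hermC expr0 mul1r. Qed.

Lemma ripC x y : rip x y = rip y x.
Proof. by rewrite /rip ipC; case: (ip y x). Qed.

Lemma ripPl (a : R) x y z : rip (a%:C *: x + y) z = a * rip x z + rip y z.
Proof. by rewrite /rip linearPl /= -ReZ; case: (a%:C * _) => ? ?; case: (ip y z). Qed.

Lemma ripDl x y z : rip (x + y) z = rip x z + rip y z.
Proof. by have := ripPl 1 x y z; rewrite scale1r mul1r. Qed.

Lemma rip0l z : rip 0 z = 0.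
Proof. by have := ripDl 0 0 z; rewrite addr0; lra. Qed.

Lemma ripZl a x z : rip (a%:C *: x) z = a * rip x z.
Proof. by have := ripPl a x 0 z; rewrite addr0 rip0l addr0. Qed.

Lemma ripNl x z : rip (- x) z = - rip x z.
Proof. by have := ripDl x (- x) z; rewrite subrr rip0l; lra. Qed.

Lemma ripBl x y z : rip (x - y) z = rip x z - rip y z.
Proof. by rewrite ripDl ripNl. Qed.

Lemma ripDr x y z : rip z (x + y) = rip z x + rip z y.
Proof. by rewrite ripC ripDl !(ripC z). Qed.

Lemma rip0r z : rip z 0 = 0.
Proof. by rewrite ripC rip0l. Qed.

Lemma ripZr a x z : rip z (a%:C *: x) = a * rip z x.
Proof. by rewrite ripC ripZl (ripC z). Qed.

Lemma ripNr x z : rip z (- x) = - rip z x.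
Proof. by rewrite ripC ripNl (ripC z). Qed.

Lemma ripBr x y z : rip z (x - y) = rip z x - rip z y.
Proof. by rewrite ripDr ripNr. Qed.

Definition ripE := (ripDl, ripDr, ripNl, ripNr, ripZl, ripZr).

Lemma ripnr x : rip x x = nr x ^+ 2.
Proof. by rewrite /rip -ipN nrE expr2 -rmorphM /= expr2. Qed.

(** The real form determines the complex one; statements about [ip], such as membership in the
    adjoint graph or positivity, are reached through this. *)
Lemma Im_ip x y : complex.Im (ip x y) = rip x ('i *: y).
Proof.
rewrite /rip ipC (ipC x ('i *: y)) linearZl /=; case: (ip y x) => u v /=.
by rewrite mul0r mul1r add0r.
Qed.

Lemma rip_i x y : rip ('i *: x) y = - rip x ('i *: y).
Proof.
by rewrite ripC -!Im_ip ipC; case: (ip x y).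
Qed.

Lemma rip_symform W : symform W rip.
Proof. by split=> *; [exact: ripPl | exact: ripC]. Qed.

Lemma rip_le x y : `|rip x y| <= nr x * nr y.
Proof.
have h := @form_cs _ _ classical_sets.setT rip _ (rip_symform _) _ x y I I.
apply: le_trans (h _ _) _ => //; first by move=> z; rewrite ripnr sqr_ge0.
by rewrite !ripnr !sqrtr_sqr !ger0_norm ?nr_ge0.
Qed.

Lemma nr_le_rip x c : 0 <= c -> rip x x <= c * nr x -> nr x <= c.
Proof.
rewrite ripnr => c0 h; have := nr_ge0 x; rewrite le_eqVlt => /predU1P[<- //|x0].
by rewrite -(ler_pM2r x0) -expr2.
Qed.

(** Testing against every [z] turns vector identities into real ones that [ring] decides. *)
Lemma rip_ext (x y : H) : (forall z, rip x z = rip y z) -> x = y.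
Proof.
move=> h; apply/subr0_eq/nr0_eq0/eqP; rewrite -sqrf_eq0 -ripnr.
by rewrite ripBl h subrr.
Qed.

Definition dense_in (W : set H) :=
  forall x (e : R), 0 < e -> exists2 w, W w & nr (x - w) < e.

(* [1 - rho A] has q-norm at most [sqrt (1 + rho^2 M)]; as it is symmetric for
   the inner product, [krein] transfers this bound to the Hilbert norm. *)
Lemma lyapunov W (q : H -> H -> R) (A : H -> H) (M : R) :
  linset W -> symform W q -> (forall x, W x -> nr x ^+ 2 <= q x x) ->
  (forall x, W x -> W (A x)) ->
  (forall x y, W x -> W y -> rip (A x) y = rip x (A y)) ->
  0 <= M -> (forall x, W x -> q (A x) (A x) <= M * q x x) ->
  (forall x, W x -> 0 <= q (A x) x) ->
  forall x, W x -> 0 <= rip (A x) x.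
Proof.
move=> lW sq qn WA sA M0 qA acc x Wx.
have [ql qs] := sq.
(* In the q-norm of [K y] the cross term has a favourable sign by hypothesis, so only [r^2 M]
   remains. Expanding [|K x|^2] and dividing by [r] leaves an error of order [r]. *)
have key (r : R) : 0 < r -> - (2 * rip (A x) x) <= r * (M * nr x ^+ 2).
  move=> r0; pose K y := (- r)%:C *: A y + y.
  have WK y : W y -> W (K y) by move=> Wy; apply: lW => //; exact: WA.
  have : rip (K x) (K x) <= (1 + r ^+ 2 * M) * rip x x.
    apply: (krein (N := fun y => q y y) lW (rip_symform W) _ WK) => //.
    - by move=> y Wy; rewrite ripnr sqr_ge0.
    - by move=> y z Wy Wz; rewrite /K !ripE sA.
    - by move=> y Wy; rewrite ripnr qn.
    - by have := mulr_ge0 (sqr_ge0 r) M0; lra.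
    - move=> y Wy; have WAy := WA _ Wy; have WKy := WK _ Wy.
      have -> : q (K y) (K y) = r ^+ 2 * q (A y) (A y) - 2 * r * q (A y) y + q y y.
        rewrite {1}/K ql // !(qs _ (K y)) // /K !ql // (qs y (A y)) //; ring.
      have := acc _ Wy; have := qA _ Wy; have := sqr_ge0 r; nra.
  have -> : rip (K x) (K x) = nr x ^+ 2 - 2 * r * rip (A x) x + r ^+ 2 * nr (A x) ^+ 2.
    by rewrite /K !ripE -!ripnr (ripC x (A x)); ring.
  rewrite ripnr => h; rewrite -(ler_pM2l r0); have := sqr_ge0 (nr (A x)); nra.
rewrite leNgt; apply/negP => hneg.
pose P := M * nr x ^+ 2 + 1.
have P0 : 0 < P by rewrite /P ltr_wpDl // mulr_ge0 ?sqr_ge0.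
(* A value of [r] small enough that the error [r M |x|^2] stays below [- rip (A x) x]. *)
have := key (- rip (A x) x / P); rewrite divr_gt0 ?oppr_gt0 // => /(_ isT).
rewrite mulrAC ler_pdivlMr // /P.
have := sqr_ge0 (nr x); have := mulr_ge0 M0 (sqr_ge0 (nr x)); nra.
Qed.

End InnerProduct.

(** * Self-adjoint operators *)

Section LinearMaps.
Variables (R : realType) (H : completeNormedModType R[i]) (f : H -> H).
Hypothesis lf : linear f.

Lemma linD x y : f (x + y) = f x + f y.
Proof. by have := lf 1 x y; rewrite !scale1r. Qed.

Lemma lin0 : f 0 = 0.
Proof. by apply: (addrI (f 0)); rewrite -linD !addr0. Qed.

Lemma linZ a x : f (a *: x) = a *: f x.
Proof. by have := lf a x 0; rewrite lin0 !addr0. Qed.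

Lemma linN x : f (- x) = - f x.
Proof. by rewrite -scaleN1r linZ scaleN1r. Qed.

Lemma linB x y : f (x - y) = f x - f y.
Proof. by rewrite linD linN. Qed.
End LinearMaps.

Section SelfAdjointFacts.
Variables (R : realType) (H : completeNormedModType R[i]).
Variables (ip : {dot H for Num.conj}).
Hypothesis ipN : induces_norm ip.
Local Notation rip := (rip ip).
Implicit Types D : unbounded_op H.

Lemma dom_linset D : linset (dom D).
Proof. by move=> a x y; apply: dom_linear. Qed.

Lemma domD D x y : dom D x -> dom D y -> dom D (x + y).
Proof. by move=> Dx Dy; have := dom_linear 1 Dx Dy; rewrite scale1r. Qed.

Lemma domZ D a x : dom D x -> dom D (a *: x).
Proof. by move=> Dx; have := dom_linear a Dx (dom0 D); rewrite addr0. Qed.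

Lemma domN D x : dom D x -> dom D (- x).
Proof. by rewrite -scaleN1r; apply: domZ. Qed.

Lemma domB D x y : dom D x -> dom D y -> dom D (x - y).
Proof. by move=> Dx Dy; apply: domD => //; apply: domN. Qed.

Lemma appD D x y : dom D x -> dom D y -> D (x + y) = D x + D y.
Proof. by move=> Dx Dy; have := app_linear 1 Dx Dy; rewrite !scale1r. Qed.

Lemma app0 D : D 0 = 0.
Proof. by apply: (addrI (D 0)); rewrite -appD ?addr0 //; exact: dom0. Qed.

Lemma appZ D a x : dom D x -> D (a *: x) = a *: D x.
Proof. by move=> Dx; have := app_linear a Dx (dom0 D); rewrite app0 !addr0. Qed.

Lemma appN D x : dom D x -> D (- x) = - D x.
Proof. by move=> Dx; rewrite -scaleN1r appZ // scaleN1r. Qed.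

Lemma appB D x y : dom D x -> dom D y -> D (x - y) = D x - D y.
Proof. by move=> Dx Dy; rewrite appD ?appN //; apply: domN. Qed.

Section OneOperator.
Variable D : unbounded_op H.
Hypothesis D_sa : self_adjoint ip D.

Lemma sa_sym x y : dom D x -> dom D y -> rip (D x) y = rip x (D y).
Proof.
move=> Dx Dy; have : graph D (y, D y) by split.
by rewrite -D_sa.2 => /(_ x Dx); rewrite /rip /= => ->.
Qed.

(** Real parts suffice: the domain is a complex subspace, and testing with ['i *: x] supplies the
    imaginary parts. *)
Lemma sa_adjoint y p : (forall x, dom D x -> rip (D x) y = rip x p) ->
  dom D y /\ D y = p.
Proof.
move=> h; suff : graph D (y, p) by move=> [].
rewrite -D_sa.2 => x Dx /=.
have h1 := h x Dx; have := h _ (domZ 'i Dx); rewrite appZ // !rip_i -!Im_ip.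
move: h1; rewrite /rip; case: (ip (D x) y) => u v; case: (ip x p) => s t /=.
by move=> -> /oppr_inj ->.
Qed.

Lemma sa_dense : dense_in (dom D).
Proof.
move=> x e e0.
have [|w [hw Dw]] := D_sa.1 (interior (ball x e%:C)) _ (open_interior _).
  by exists x; apply: nbhsx_ballx; rewrite ltcR.
exists w => //; by move/interior_subset: hw; rewrite -ball_normE /ball_ /= nrE ltcR.
Qed.

Lemma rip_approx (u v w : H) e : nr (u - v) <= e -> `|rip u w - rip v w| <= e * nr w.
Proof.
move=> h; rewrite -ripBl; apply: le_trans (rip_le ipN _ _) _.
by rewrite ler_wpM2r ?nr_ge0.
Qed.

(** An adjoint has a closed graph. Asking for one approximant per [e] serves minimising sequences
    and operator limits alike. *)
Lemma sa_closed l p :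
  (forall e : R, 0 < e -> exists u, [/\ dom D u, nr (u - l) <= e & nr (D u - p) <= e]) ->
  dom D l /\ D l = p.
Proof.
move=> h; apply: sa_adjoint => x Dx.
apply/eqP; rewrite -subr_eq0 -normr_eq0 eq_le normr_ge0 andbT.
apply/ler_addgt0Pl => e e0; rewrite addr0.
pose c := nr x + nr (D x) + 1.
have c0 : 0 < c by have := nr_ge0 x; have := nr_ge0 (D x); rewrite /c; lra.
have [u [Du u1 u2]] := h _ (divr_gt0 e0 c0).
have := rip_approx (D x) u1; have := rip_approx x u2.
rewrite !(ripC _ _ x) !(ripC _ _ (D x)) (sa_sym Dx Du) => h1 h2.
have -> : rip (D x) l - rip x p = (rip x (D u) - rip x p) - (rip x (D u) - rip (D x) l).
  ring.
apply: le_trans (ler_normB _ _) _; apply: (@le_trans _ _ (e / c * (nr x + nr (D x)))).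
  by rewrite mulrDr lerD.
rewrite mulrAC ler_pdivrMr // ler_pM2l // /c; lra.
Qed.

Lemma shifted_sq_inj x : dom_sq D x -> x + D (D x) = 0 -> x = 0.
Proof.
move=> [Dx DDx] e; apply: nr0_eq0; apply/eqP; rewrite -sqrf_eq0 eq_le sqr_ge0 andbT.
have := rip0l ip x; rewrite -e ripDl (sa_sym DDx) // !(ripnr ipN).
by have := sqr_ge0 (nr (D x)); lra.
Qed.

(* Minimise [|x - f|^2 + |D x|^2] over the domain of D. *)
Lemma shifted_sq_surj f : exists x, dom_sq D x /\ x + D (D x) = f.
Proof.
pose a x := nr (x - f) ^+ 2 + nr (D x) ^+ 2.
have a0 x : 0 <= a x by rewrite addr_ge0 ?sqr_ge0.
pose S := [set a x | x in dom D].
pose d := inf S.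
have hS : has_inf S.
  by split; [exists (a 0), 0 => //; exact: dom0 | exists 0 => _ [x _ <-]].
have dle x : dom D x -> d <= a x by move=> Dx; apply: ge_inf; [exact: hS.2 | exists x].
have ex (n : nat) : exists x, dom D x /\ a x < d + n.+1%:R^-1.
  have [|_ [x Dx <-] h] := inf_adherent (eps := n.+1%:R^-1) _ hS; last by exists x.
  by rewrite invr_gt0.
have [u hu] := choice ex.
(* Parallelogram identity at the midpoint, where [a] is at least [d]: the minimising sequence is
   Cauchy in the graph norm. *)
have key m n : nr (u m - u n) ^+ 2 + nr (D (u m) - D (u n)) ^+ 2 <=
    2 * (m.+1%:R^-1 + n.+1%:R^-1).
  have [Dm am] := hu m; have [Dn an] := hu n.
  have Dh : dom D (2^-1%:C *: (u m + u n)) by apply: domZ; apply: domD.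
  have := dle _ Dh; move: am an; rewrite /a appZ ?appD //; last exact: domD.
  rewrite -!(ripnr ipN) !ripE !(ripC _ (u n) (u m)) !(ripC _ (D (u n)) (D (u m))).
  rewrite !(ripC _ f); move: m.+1%:R^-1 n.+1%:R^-1 => i j h1 h2 h3; lra.
have cau (v : nat -> H) : (forall m n, nr (v m - v n) ^+ 2 <= 2 * (m.+1%:R^-1 + n.+1%:R^-1)) ->
    exists l, forall e : R, 0 < e -> exists N, forall n, (N <= n)%N -> nr (v n - l) < e.
  move=> hv; apply: nr_cauchy => e e0.
  have e20 : 0 < e ^+ 2 / 4 by rewrite divr_gt0 ?exprn_gt0.
  have [N inv] := inv_natS_lt e20; exists N => m n Nm Nn.
  rewrite -(@ltr_pXn2r _ 2) ?nnegrE ?nr_ge0 ?ltW //.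
  by apply: le_lt_trans (hv _ _) _; move: (inv m Nm) (inv n Nn); move: m.+1%:R^-1 n.+1%:R^-1 => i j; lra.
have [|x hx] := cau u.
  by move=> m n; apply: le_trans (key m n); rewrite lerDl sqr_ge0.
have [|p hp] := cau (fun n => D (u n)).
  by move=> m n; apply: le_trans (key m n); rewrite lerDr sqr_ge0.
have [Dx Dxp] : dom D x /\ D x = p.
  apply: sa_closed => e e0; have [N1 h1] := hx _ e0; have [N2 h2] := hp _ e0.
  exists (u (maxn N1 N2)); split; first exact: (hu _).1.
    by rewrite ltW // h1 // leq_maxl.
  by rewrite ltW // h2 // leq_maxr.
(* The Euler-Lagrange equation of the minimum, read as membership of [p = D x] in the domain of the
   adjoint. *)
have [Dp Dpe] : dom D p /\ D p = f - x.
  apply: sa_adjoint => z Dz.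
  apply/eqP; rewrite -subr_eq0 -normr_eq0 eq_le normr_ge0 andbT.
  apply/ler_addgt0Pl => e e0; rewrite addr0.
  pose Z := nr z + nr (D z).
  have Z0 : 0 <= Z by rewrite addr_ge0 ?nr_ge0.
  (* The total error is [2 t Z]: once for near-minimality, once for replacing [u n] and [D (u n)] by
     their limits. *)
  pose t := e / (2 * (Z + 1)).
  have t0 : 0 < t by rewrite divr_gt0 // mulr_gt0 // ltr_wpDl.
  have [N1 h1] := hx _ t0; have [N2 h2] := hp _ t0.
  have [N3 h3] := inv_natS_lt (exprn_gt0 2 t0).
  pose n := maxn N1 (maxn N2 N3).
  have := h1 n (leq_maxl _ _) => /ltW /rip_approx - /(_ z) k1.
  have n2 : (N2 <= n)%N by rewrite /n !leq_max leqnn orbT.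
  have n3 : (N3 <= n)%N by rewrite /n !leq_max leqnn !orbT.
  have := h2 n n2 => /ltW /rip_approx - /(_ (D z)) k2.
  have k3 := h3 n n3.
  have [Dn an] := hu n.
  (* Half the derivative of [a] at [u n] along [z]. Since [a (u n) < d + t^2] and [d] is the
     infimum, [discr_le] bounds it. *)
  pose b := rip (u n) z - rip f z + rip (D (u n)) (D z).
  have hb : `|b| <= t * Z.
    have hb2 : b ^+ 2 <= t ^+ 2 * (nr z ^+ 2 + nr (D z) ^+ 2).
      apply: discr_le; rewrite ?sqr_ge0 ?addr_ge0 ?sqr_ge0 // => r.
      have := dle _ (domD Dn (domZ (- r)%:C Dz)); move: an k3.
      rewrite /a /b appD ?appZ //; last exact: domZ.
      rewrite -!(ripnr ipN) !ripE !(ripC _ f) !(ripC _ z) (ripC _ (D z) (D (u n))).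
      by move: n.+1%:R^-1 => i h3' h1' h2'; lra.
    rewrite -(@ler_pXn2r _ 2) ?nnegrE ?normr_ge0 ?(mulr_ge0 (ltW t0) Z0) //.
    rewrite real_normK ?num_real // exprMn; apply: le_trans hb2 _.
    rewrite ler_wpM2l ?sqr_ge0 // /Z.
    by have := mulr_ge0 (nr_ge0 z) (nr_ge0 (D z)); lra.
  have -> : rip (D z) p - rip z (f - x) =
      b - (rip (u n) z - rip x z) - (rip (D (u n)) (D z) - rip p (D z)).
    rewrite /b ripBr !(ripC _ z) (ripC _ _ p); ring.
  apply: le_trans (ler_normB _ _) _; apply: le_trans (lerD (ler_normB _ _) (lexx _)) _.
  apply: (@le_trans _ _ (2 * t * Z)); first by rewrite /Z in hb *; lra.
  rewrite /t; have -> : 2 * (e / (2 * (Z + 1))) * Z = e * Z / (Z + 1).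
    by field; rewrite gt_eqF // ltr_wpDl.
  by rewrite ler_pdivrMr ?ltr_wpDl // ler_wpM2l ?(ltW e0) // lerDl.
by exists x; split; [split; rewrite ?Dxp | rewrite Dxp Dpe addrC subrK].
Qed.
End OneOperator.
End SelfAdjointFacts.

(** * Square roots of positive contractions *)

Section SquareRoot.
Variables (R : realType) (H : completeNormedModType R[i]).
Variables (ip : {dot H for Num.conj}).
Hypothesis ipN : induces_norm ip.
Local Notation rip := (rip ip).

Fixpoint sqit_bound n : R :=
  if n is n'.+1 then 2^-1 * (1 + sqit_bound n' ^+ 2) else 0.

Lemma sqit_bound_itv n : 0 <= sqit_bound n <= 1.
Proof. by elim: n => [|n /andP[h0 h1]] /=; rewrite ?lexx ?ler01 //; nra. Qed.

(** Some term [N] is within [e] of the supremum, so no term exceeds it by [e]. *)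
Lemma sqit_bound_cauchy (e : R) : 0 < e ->
  exists N, forall n, (N <= n)%N -> sqit_bound n - sqit_bound N < e.
Proof.
move=> e0; pose S := [set sqit_bound n | n in classical_sets.setT].
have hS : has_sup S.
  split; first by exists 0, 0%N.
  by exists 1 => _ [n _ <-]; have /andP[] := sqit_bound_itv n.
have [_ [N _ <-] hN] := sup_adherent e0 hS.
exists N => n _; have h : sqit_bound n <= sup S.
  by apply: ub_le_sup; [exact: hS.2 | exists n].
by move: h hN; rewrite -/S; lra.
Qed.

Variable A : H -> H.
Hypothesis lA : linear A.
Hypothesis symA : forall x y, rip (A x) y = rip x (A y).
Hypothesis nA : forall x, nr (A x) <= nr x.

(* Successive approximations of [1 - (1 - A)^(1/2)], the solution Y of
   [2 Y = A + Y^2]; [sqit_bound] is the scalar iteration for A = 1. *)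
Fixpoint sqit n (x : H) : H :=
  if n is n'.+1 then (2^-1 : R)%:C *: (A x + sqit n' (sqit n' x)) else 0.

Lemma sqit_linear n : linear (sqit n).
Proof.
elim: n => [|n IH] a x y /=; first by rewrite scaler0 addr0.
by rewrite lA !IH addrACA -scalerDr [LHS]scalerDr !scalerA (mulrC a).
Qed.

(** Each [sqit n] is a polynomial in [A]. *)
Lemma sqit_commute (T : H -> H) n x : linear T ->
  (forall z, T (A z) = A (T z)) -> T (sqit n x) = sqit n (T x).
Proof.
move=> lT TA; elim: n x => [|n IH] x /=; first by rewrite (lin0 lT).
by rewrite (linZ lT) (linD lT) TA !IH.
Qed.

Lemma sqitA n x : A (sqit n x) = sqit n (A x).
Proof. exact: sqit_commute. Qed.

Lemma sqitC m n x : sqit m (sqit n x) = sqit n (sqit m x).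
Proof. by apply: sqit_commute => [|z]; [exact: sqit_linear | rewrite sqitA]. Qed.

Lemma sqit_sym n x y : rip (sqit n x) y = rip x (sqit n y).
Proof.
elim: n x y => [|n IH] x y /=; first by rewrite rip0l rip0r.
by rewrite !ripE symA !IH.
Qed.

Lemma sqit_nr n x : nr (sqit n x) <= sqit_bound n * nr x.
Proof.
elim: n x => [|n IH] x /=; first by rewrite nr0 mul0r.
have /andP[s0 _] := sqit_bound_itv n.
rewrite nrZ ger0_norm ?invr_ge0 // -mulrA ler_wpM2l ?invr_ge0 //.
apply: le_trans (nrD _ _) _; rewrite mulrDl mul1r lerD //.
by apply: le_trans (IH _) _; rewrite expr2 -mulrA ler_wpM2l.
Qed.

(** Polynomials in [A] commute, so [Y'^2 - Y^2 = (Y' + Y) (Y' - Y)] for consecutive iterates; the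
    scalar iteration obeys the same recursion and majorises the norms. *)
Lemma sqit_step n x :
  nr (sqit n.+1 x - sqit n x) <= (sqit_bound n.+1 - sqit_bound n) * nr x.
Proof.
elim: n x => [|n IH] x; first by rewrite !subr0; exact: sqit_nr.
have -> : sqit n.+2 x - sqit n.+1 x = (2^-1 : R)%:C *:
    (sqit n.+1 (sqit n.+1 x - sqit n x) + sqit n (sqit n.+1 x - sqit n x)).
  rewrite !(linB (sqit_linear _)) (sqitC n n.+1) addrA subrK.
  by rewrite [LHS]/= -scalerBr opprD addrACA subrr add0r.
have /andP[s0 _] := sqit_bound_itv n; have /andP[s1 _] := sqit_bound_itv n.+1.
rewrite nrZ ger0_norm ?invr_ge0 //.
have h1 := sqit_nr n.+1 (sqit n.+1 x - sqit n x).
have h2 := sqit_nr n (sqit n.+1 x - sqit n x).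
have h3 := nrD (sqit n.+1 (sqit n.+1 x - sqit n x)) (sqit n (sqit n.+1 x - sqit n x)).
have -> : sqit_bound n.+2 - sqit_bound n.+1 =
  2^-1 * ((sqit_bound n.+1 + sqit_bound n) * (sqit_bound n.+1 - sqit_bound n)).
  have e k : sqit_bound k.+1 = 2^-1 * (1 + sqit_bound k ^+ 2) by [].
  have := e n; have := e n.+1; lra.
rewrite -!mulrA ler_wpM2l ?invr_ge0 //.
apply: le_trans h3 _; apply: le_trans (lerD h1 h2) _; rewrite -mulrDl ler_wpM2l ?addr_ge0 //.
Qed.

Lemma sqit_dist m n x : (n <= m)%N ->
  nr (sqit m x - sqit n x) <= (sqit_bound m - sqit_bound n) * nr x.
Proof.
move=> /subnK <-; elim: (m - n)%N => [|k IH]; first by rewrite add0n !subrr nr0 mul0r.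
apply: le_trans (nr_tri _ (sqit (k + n) x) _) _.
by have := sqit_step (k + n) x; have := IH; rewrite addSn; lra.
Qed.

(** The scalar majorant gives convergence in operator norm even when [A] has norm 1. Uniformity lets
    the algebra pass to the limit. *)
Lemma sqit_cvg : exists Y : H -> H, forall e : R, 0 < e ->
  exists N, forall n x, (N <= n)%N -> nr (sqit n x - Y x) <= e * nr x.
Proof.
have key e : 0 < e -> exists N, forall m n x, (N <= m)%N -> (N <= n)%N ->
    nr (sqit m x - sqit n x) <= e * nr x.
  move=> e0; have [N hN] := sqit_bound_cauchy (divr_gt0 e0 (ltr0n _ 2)).
  exists N => m n x Nm Nn; apply: le_trans (nr_tri _ (sqit N x) _) _.
  rewrite (nrB (sqit N x)).
  have := sqit_dist x Nm; have := sqit_dist x Nn.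
  have := ler_wpM2r (nr_ge0 x) (ltW (hN _ Nm)).
  by have := ler_wpM2r (nr_ge0 x) (ltW (hN _ Nn)); lra.
have ex x : exists l, forall e : R, 0 < e -> exists N, forall n, (N <= n)%N -> nr (sqit n x - l) < e.
  apply: nr_cauchy => e e0; have x0 : 0 < nr x + 1 by rewrite ltr_wpDl ?nr_ge0.
  have [N hN] := key _ (divr_gt0 e0 x0); exists N => m n Nm Nn.
  apply: le_lt_trans (hN _ _ x Nm Nn) _.
  by rewrite mulrAC ltr_pdivrMr // ltr_pM2l // ltrDl.
have [Y hY] := choice ex; exists Y => e e0; have [N hN] := key e e0.
exists N => n x Nn; apply/ler_addgt0Pl => d d0.
have [N' hN'] := hY x d d0.
apply: le_trans (nr_tri _ (sqit (maxn N N') x) _) _; rewrite addrC lerD //.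
  by rewrite ltW // hN' // leq_maxr.
by apply: hN => //; rewrite leq_maxl.
Qed.
End SquareRoot.

Section SquareRootLimit.
Variables (R : realType) (H : completeNormedModType R[i]).
Variables (ip : {dot H for Num.conj}).
Hypothesis ipN : induces_norm ip.
Local Notation rip := (rip ip).

Lemma le_scaled_all (a C : R) : (forall e, 0 < e -> a <= e * C) -> a <= 0.
Proof.
move=> h; apply/ler_addgt0Pl => e e0; rewrite addr0.
have C0 : 0 < `|C| + 1 by rewrite ltr_wpDl.
apply: le_trans (h _ (divr_gt0 e0 C0)) _.
by rewrite mulrAC ler_pdivrMr // ler_pM2l //; have := ler_norm C; lra.
Qed.

Lemma eq_scaled (u v : H) C : (forall e, 0 < e -> nr (u - v) <= e * C) -> u = v.
Proof.
move=> h; apply/subr0_eq/nr0_eq0/eqP; rewrite eq_le nr_ge0 andbT.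
exact: (le_scaled_all h).
Qed.

Lemma eqr_scaled (u v C : R) : (forall e, 0 < e -> `|u - v| <= e * C) -> u = v.
Proof.
move=> h; apply/subr0_eq/eqP; rewrite -normr_eq0 eq_le normr_ge0 andbT.
exact: (le_scaled_all h).
Qed.

Lemma nrZc (a : R[i]) (x : H) : nr (a *: x) = complex.Re `|a| * nr x.
Proof. by rewrite {1}/nr normrZ nrE normc_def -rmorphM. Qed.

Variable A : H -> H.
Hypothesis lA : linear A.
Hypothesis symA : forall x y, rip (A x) y = rip x (A y).
Hypothesis nA : forall x, nr (A x) <= nr x.
Variable Y : H -> H.
Hypothesis YP : forall e : R, 0 < e ->
  exists N, forall n x, (N <= n)%N -> nr (sqit A n x - Y x) <= e * nr x.

Lemma sqlim_approx (e : R) : 0 < e -> exists n, forall x, nr (sqit A n x - Y x) <= e * nr x.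
Proof. by move=> /YP[N h]; exists N => x; exact: h. Qed.

Lemma sqlim_linear : linear Y.
Proof.
move=> a x y.
apply: (@eq_scaled _ _ (nr (a *: x + y) + (complex.Re `|a| * nr x + nr y))) => e e0.
have [n hn] := sqlim_approx e0.
have -> : Y (a *: x + y) - (a *: Y x + Y y) =
   - (sqit A n (a *: x + y) - Y (a *: x + y)) + (a *: (sqit A n x - Y x) + (sqit A n y - Y y)).
  rewrite (sqit_linear lA) scalerBr; apply: (rip_ext ipN) => z; rewrite !ripE; ring.
apply: le_trans (nrD _ _) _; rewrite mulrDr nrN lerD ?hn //.
apply: le_trans (nrD _ _) _; rewrite mulrDr nrZc mulrCA lerD ?hn // ler_wpM2l ?hn //.
by have := normr_ge0 a; rewrite normc_def lecR.
Qed.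

Lemma sqlim_commute (T : H -> H) (C : R) x : linear T ->
  (forall z, nr (T z) <= C * nr z) ->
  (forall z, T (A z) = A (T z)) -> T (Y x) = Y (T x).
Proof.
move=> lT bT TA; apply: (@eq_scaled _ _ (`|C| * nr x + nr (T x))) => e e0.
have [n hn] := sqlim_approx e0.
have -> : T (Y x) - Y (T x) = - T (sqit A n x - Y x) + (sqit A n (T x) - Y (T x)).
  by rewrite (linB lT) (sqit_commute n x lT TA) opprB addrA subrK.
apply: le_trans (nrD _ _) _; rewrite mulrDr nrN lerD ?hn //.
apply: le_trans (bT _) _; rewrite mulrCA.
apply: le_trans (ler_wpM2r (nr_ge0 _) (ler_norm C)) _.
by rewrite ler_wpM2l ?hn.
Qed.

Lemma sqlim_nr x : nr (Y x) <= nr x.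
Proof.
rewrite -subr_le0; apply: (@le_scaled_all _ (nr x)) => e e0.
have [n hn] := sqlim_approx e0.
have := nr_tri 0 (sqit A n x) (Y x); rewrite !sub0r !nrN.
have /andP[_ h1] := sqit_bound_itv R n; have := sqit_nr nA n x.
have := ler_wpM2r (nr_ge0 x) h1; have := hn x.
have := nr_tri (Y x) (sqit A n x) 0; rewrite !subr0 (nrB (Y x)); lra.
Qed.

Lemma sqlim_sym x y : rip (Y x) y = rip x (Y y).
Proof.
apply: (@eqr_scaled _ _ (2 * (nr x * nr y))) => e e0.
have [n hn] := sqlim_approx e0.
have -> : rip (Y x) y - rip x (Y y) =
    rip x (sqit A n y - Y y) - rip (sqit A n x - Y x) y.
  by rewrite ripBr ripBl (sqit_sym symA); ring.
have h1 := le_trans (rip_le ipN _ _) (ler_wpM2r (nr_ge0 y) (hn x)).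
have h2 := le_trans (rip_le ipN _ _) (ler_wpM2l (nr_ge0 x) (hn y)).
by apply: le_trans (ler_normB _ _) _; lra.
Qed.

Lemma sqlim_eq x : A x + Y (Y x) = Y x + Y x.
Proof.
have l2 (z : H) : z + z = (2 : R)%:C *: z by apply: (rip_ext ipN) => w; rewrite !ripE; ring.
(* Two errors come from the iterate [N1.+1], and one from each factor of the square. *)
apply: (@eq_scaled _ _ (4 * nr x)) => e e0.
have [N1 h1] := YP e0.
have hn := h1 N1 _ (leqnn _); have hn1 := h1 N1.+1 _ (leqnSn _).
have e1 : sqit A N1.+1 x + sqit A N1.+1 x = A x + sqit A N1 (sqit A N1 x).
  by rewrite l2 /= scalerA -rmorphM /= divff // scale1r.
have -> : A x + Y (Y x) - (Y x + Y x) =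
   (sqit A N1.+1 x - Y x) + (sqit A N1.+1 x - Y x)
   - (sqit A N1 (sqit A N1 x - Y x)) - (sqit A N1 (Y x) - Y (Y x)).
  rewrite addrACA e1 (linB (sqit_linear lA N1)).
  by apply: (rip_ext ipN) => z; rewrite !ripE; ring.
have /andP[_ hb] := sqit_bound_itv R N1.
have := nrD (sqit A N1.+1 x - Y x + (sqit A N1.+1 x - Y x) - sqit A N1 (sqit A N1 x - Y x)) (- (sqit A N1 (Y x) - Y (Y x))).
have := nrD (sqit A N1.+1 x - Y x + (sqit A N1.+1 x - Y x)) (- sqit A N1 (sqit A N1 x - Y x)).
have := nrD (sqit A N1.+1 x - Y x) (sqit A N1.+1 x - Y x).
have := sqit_nr nA N1 (sqit A N1 x - Y x).
have := ler_wpM2r (nr_ge0 (sqit A N1 x - Y x)) hb.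
have := hn x; have := hn1 x; have := hn (Y x).
have := ler_wpM2l (ltW e0) (sqlim_nr x).
rewrite !nrN; lra.
Qed.

(** The iterates commute with [D] on its domain, and the graph of [D] is closed. *)
Lemma sqlim_commute_unbounded (D : unbounded_op H) x : self_adjoint ip D ->
  (forall z, dom D z -> dom D (A z) /\ D (A z) = A (D z)) ->
  dom D x -> dom D (Y x) /\ D (Y x) = Y (D x).
Proof.
move=> D_sa hA Dx.
have key n z : dom D z -> dom D (sqit A n z) /\ D (sqit A n z) = sqit A n (D z).
  elim: n z => [|n IH] z Dz /=; first by rewrite app0; split => //; exact: dom0.
  have [a1 a2] := hA _ Dz; have [b1 b2] := IH _ Dz; have [c1 c2] := IH _ b1.
  have d1 := domD a1 c1; split; first exact: domZ.
  by rewrite appZ // appD // a2 c2 b2.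
apply: (sa_closed ipN D_sa) => e e0.
have c0 : 0 < nr x + nr (D x) + 1 by have := nr_ge0 x; have := nr_ge0 (D x); lra.
have [n hn] := sqlim_approx (divr_gt0 e0 c0).
have [k1 k2] := key n x Dx.
exists (sqit A n x); split => //.
  apply: le_trans (hn _) _; rewrite mulrAC ler_pdivrMr // ler_pM2l //.
  by have := nr_ge0 (D x); lra.
rewrite k2; apply: le_trans (hn _) _; rewrite mulrAC ler_pdivrMr // ler_pM2l //.
by have := nr_ge0 x; lra.
Qed.
End SquareRootLimit.

(** * Existence and uniqueness of (1 + D^2)^(-1/2) *)

Section InverseRoot.
Variables (R : realType) (H : completeNormedModType R[i]).
Variables (ip : {dot H for Num.conj}).
Hypothesis ipN : induces_norm ip.
Local Notation rip := (rip ip).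

Record root_spec (D : unbounded_op H) (B : H -> H) : Prop := RootSpec {
  root_linear : linear B;
  root_sym : forall x y, rip (B x) y = rip x (B y);
  root_pos : forall x, 0 <= rip (B x) x;
  root_nr : forall x, nr (B x) <= nr x;
  root_sq : forall x, dom_sq D (B (B x)) /\ B (B x) + D (D (B (B x))) = x;
  root_comm : forall x, dom D x -> dom D (B x) /\ D (B x) = B (D x) }.

Lemma ip_ge0E (x y : H) : (0 <= ip x y) = (rip x ('i *: y) == 0) && (0 <= rip x y).
Proof. by rewrite -Im_ip /rip lecE eq_sym. Qed.

(** A complex sesquilinear form that is real on the diagonal is hermitian: polarise at [x + y], then
    replace [y] by ['i *: y]. *)
Lemma positive_sym (B : H -> H) : linear B -> (forall x, 0 <= ip (B x) x) ->
  forall x y, rip (B x) y = rip x (B y).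
Proof.
move=> lB pB.
have h x : rip (B x) ('i *: x) = 0.
  by have := pB x; rewrite ip_ge0E => /andP[/eqP].
have h2 x y : rip (B x) ('i *: y) + rip (B y) ('i *: x) = 0.
  have := h (x + y); rewrite (linD lB) scalerDr !ripE !h; lra.
move=> x y; have := h2 x ('i *: y).
rewrite scalerA -expr2 sqr_i scaleN1r (linZ lB) rip_i scalerA -expr2 sqr_i scaleN1r.
by rewrite !ripNr (ripC _ x); lra.
Qed.

(** Cauchy-Schwarz for the form of [B], between [x] and [B x]. *)
Lemma psd_kernel (B : H -> H) : linear B -> (forall x y, rip (B x) y = rip x (B y)) ->
  (forall x, 0 <= rip (B x) x) -> forall x, rip (B x) x = 0 -> B x = 0.
Proof.
move=> lB sB pB x hx.
have hs : symform (classical_sets.setT : set H) (fun x y => rip (B x) y).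
  split=> [a u v w|u v] *; last by rewrite sB ripC.
  by rewrite (linD lB) (linZ lB) !ripE.
have := form_cs2 (W := classical_sets.setT) (fun _ _ _ _ _ => I) hs
  (fun z _ => pB z) (x := x) (z := B x) I I.
rewrite hx mul0r (ripnr ipN) => h; apply: nr0_eq0; apply/eqP.
by rewrite -sqrf_eq0 -sqrf_eq0 eq_le h sqr_ge0.
Qed.

Lemma nr_sub_le (u v : H) c : nr (u + v) ^+ 2 = c ^+ 2 -> 0 <= c -> 0 <= rip u v -> nr v <= c.
Proof.
move=> h c0 p; rewrite -(@ler_pXn2r _ 2) ?nnegrE ?nr_ge0 //.
rewrite -h -!(ripnr ipN) !ripE (ripC _ v u).
by have := sqr_ge0 (nr u); rewrite -(ripnr ipN); lra.
Qed.

Lemma bounded_real (T : H -> H) (M : R) : linear T ->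
  (forall x, nr (T x) <= M * nr x) -> bounded_op T.
Proof.
by move=> lT h; split=> //; exists M => x; rewrite !nrE -rmorphM lecR.
Qed.

(** The last clause, that the root commutes with whatever commutes with its square, is what
    uniqueness rests on. *)
Lemma root_exists (D : unbounded_op H) : self_adjoint ip D ->
  exists B, [/\ root_spec D B, is_inv_sqrt_1sq ip D B &
    forall T C, linear T -> (forall z, nr (T z) <= C * nr z) ->
      (forall z, T (B (B z)) = B (B (T z))) -> forall x, T (B x) = B (T x)].
Proof.
move=> D_sa; have [Rs hR] := choice (shifted_sq_surj ipN D_sa).
have inj x y : dom_sq D x -> dom_sq D y -> x + D (D x) = y + D (D y) -> x = y.
  move=> [x1 x2] [y1 y2] h; apply/subr0_eq; apply: (shifted_sq_inj ipN D_sa).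
    by split; rewrite ?appB //; apply: domB.
  by rewrite !appB // addrACA -opprD h subrr.
have RK x : dom_sq D x -> Rs (x + D (D x)) = x.
  by move=> Dx; have [h1 h2] := hR (x + D (D x)); apply: inj.
have lR : linear Rs.
  move=> a x y; have [[x1 x2] ex] := hR x; have [[y1 y2] ey] := hR y.
  have h : dom_sq D (a *: Rs x + Rs y).
    by split; rewrite ?app_linear //; apply: dom_linear.
  rewrite -(RK _ h) !app_linear //; congr Rs.
  by rewrite addrACA -scalerDr ex ey.
have sR x y : rip (Rs x) y = rip x (Rs y).
  have [[x1 x2] ex] := hR x; have [[y1 y2] ey] := hR y.
  rewrite -{1}ey -{2}ex !ripE (sa_sym D_sa x2 y1).
  by rewrite (sa_sym D_sa x1 y2).
have RD x : dom D x -> dom D (Rs x) /\ D (Rs x) = Rs (D x).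
  move=> Dx; have [[x1 x2] ex] := hR x; split=> //.
  have e : D (D (Rs x)) = x - Rs x by rewrite -{2}ex addrC addKr.
  rewrite -[LHS]RK ?e; last by split; rewrite ?e //; apply: domB.
  by rewrite appB // addrC subrK.
(* With [Rs = (1 + D^2)^-1] this is [D^2 (1 + D^2)^-1]. It is a contraction because [Rs x] and [A x]
   add up to [x] and have nonnegative inner product. *)
pose A x := x - Rs x.
have AE x : A x = D (D (Rs x)) by have [_ e] := hR x; rewrite /A -{1}e addrC addKr.
have lA : linear A.
  move=> a x y; rewrite /A lR scalerBr; apply: (rip_ext ipN) => z; rewrite !ripE; ring.
have sA x y : rip (A x) y = rip x (A y) by rewrite /A !ripE sR.
have nA x : nr (A x) <= nr x.
  have [[x1 x2] ex] := hR x; rewrite AE; apply: (@nr_sub_le (Rs x)) => //.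
  - by rewrite ex.
  - exact: nr_ge0.
  - by rewrite -(sa_sym D_sa) // (ripnr ipN) sqr_ge0.
have AD x : dom D x -> dom D (A x) /\ D (A x) = A (D x).
  by move=> Dx; have [h1 h2] := RD x Dx; rewrite /A appB // h2; split=> //; apply: domB.
have [Y hY] := sqit_cvg lA nA.
have lY := sqlim_linear ipN lA hY; have sY := sqlim_sym ipN sA hY.
have nY := sqlim_nr nA hY; have eY := sqlim_eq ipN lA nA hY.
(* From [2 Y = A + Y^2] follows [(1 - Y)^2 = 1 - A = Rs]. *)
pose B x := x - Y x.
have lB : linear B.
  move=> a x y; rewrite /B lY scalerBr; apply: (rip_ext ipN) => z; rewrite !ripE; ring.
have sB x y : rip (B x) y = rip x (B y) by rewrite /B !ripE sY.
have pB x : 0 <= rip (B x) x.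
  rewrite /B ripBl (ripnr ipN) subr_ge0; apply: le_trans (ler_norm _) _.
  by apply: le_trans (rip_le ipN _ _) _; rewrite expr2 ler_wpM2r ?nr_ge0.
have BB x : B (B x) = Rs x.
  rewrite /B (linB lY); have : Y (Y x) = Y x + Y x - A x by rewrite -eY addrC addKr.
  move=> ->; rewrite /A; apply: (rip_ext ipN) => z; rewrite !ripE; ring.
have bB x : nr (B x) <= nr x.
  rewrite -(@ler_pXn2r _ 2) ?nnegrE ?nr_ge0 // -(ripnr ipN) sB BB.
  have [[x1 x2] ex] := hR x; rewrite -(ripnr ipN) -{1 3 4}ex !ripE.
  have := sqr_ge0 (nr (D (D (Rs x)))); have := sqr_ge0 (nr (D (Rs x))).
  rewrite -!(ripnr ipN) (sa_sym D_sa x2 x1) (sa_sym D_sa x1 x2); lra.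
exists B; split.
- split=> //; first by move=> x; rewrite BB.
  move=> x Dx; have [h1 h2] := sqlim_commute_unbounded ipN hY D_sa AD Dx.
  by rewrite /B appB // h2; split=> //; apply: domB.
- split.
  + by apply: (@bounded_real _ 1) => // x; rewrite mul1r.
  + move=> x; rewrite ip_ge0E pB andbT; apply/eqP.
    have : rip (B x) ('i *: x) = - rip (B x) ('i *: x).
      by rewrite {1}sB (linZ lB) -rip_i ripC.
    lra.
  + by move=> x; rewrite BB.
  + by move=> x Dx; rewrite BB RK.
- move=> T C lT bT cT x; rewrite /B (linB lT); congr (_ - _).
  apply: (sqlim_commute hY x lT bT) => z; rewrite /A (linB lT); congr (_ - _).
  by have := cT z; rewrite !BB.
Qed.

(** Uniqueness identifies the [get] with the constructed root [B']. As [B] and [B'] commute and have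
    equal squares, [y = B x - B' x] satisfies [B y + B' y = 0]; positivity gives [B y = 0], and
    [B^2] is injective. *)
Lemma inv_sqrt_spec (D : unbounded_op H) : self_adjoint ip D ->
  root_spec D (inv_sqrt_1sq ip D).
Proof.
move=> D_sa; have [B' [B'r B'i B'c]] := root_exists D_sa.
have : is_inv_sqrt_1sq ip D (inv_sqrt_1sq ip D) by apply: getPex; exists B'.
set B := inv_sqrt_1sq ip D => -[[lB [M bB]] pB sqB invB].
suff -> : B = B' by [].
have sB := positive_sym lB pB.
have lB' := root_linear B'r.
have BB x : B (B x) = B' (B' x).
  have [h1 h2] := root_sq B'r x.
  by rewrite -{1}h2 invB.
have cB x : B (B' x) = B' (B x).
  apply: (B'c _ M lB) => [z|z]; last by rewrite -!BB.
  by have := bB z; rewrite !nrE -rmorphM lecR.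
apply/funext => x; pose y := B x - B' x.
have h0 : B y + B' y = 0.
  rewrite /y (linB lB) (linB lB') BB cB; apply: (rip_ext ipN) => z.
  rewrite !ripE rip0l; ring.
have pB1 z : 0 <= rip (B z) z by have := pB z; rewrite ip_ge0E => /andP[].
have By0 : B y = 0.
  apply: psd_kernel => //.
  have := pB1 y; have := root_pos B'r y.
  have := rip0l ip y; rewrite -h0 ripDl; lra.
apply/subr0_eq; rewrite -/y; have [_ <-] := root_sq B'r y.
by rewrite -BB By0 (lin0 lB) !app0 addr0.
Qed.
End InverseRoot.

(** * The bounded transform *)

Section BoundedTransform.
Variables (R : realType) (H : completeNormedModType R[i]).
Variables (ip : {dot H for Num.conj}).
Hypothesis ipN : induces_norm ip.
Local Notation rip := (rip ip).
Variable D : unbounded_op H.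
Hypothesis D_sa : self_adjoint ip D.

Local Notation B := (inv_sqrt_1sq ip D).
Local Notation F := (vartheta ip D).
Let Br := inv_sqrt_spec ipN D_sa.

(* [(1 + D^2)^(1/2)] on the domain of D, as [(1 + D^2) (1 + D^2)^(-1/2)] *)
Definition absq (x : H) : H := B x + F (D x).
Local Notation S := absq.

Definition qform (x z : H) : R := rip (S x) z.

Lemma comm_B x : dom D x -> dom D (B x) /\ D (B x) = B (D x).
Proof. exact: root_comm Br x. Qed.

(** This is [F^2 + B^2 = 1], first on the domain, where [B] commutes with [D]. *)
Lemma nr_F_dom x : dom D x -> nr (D (B x)) ^+ 2 + nr (B x) ^+ 2 = nr x ^+ 2.
Proof.
move=> Dx; have [Dbx cx] := comm_B Dx; have [Dbbx cbx] := comm_B Dbx.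
have [[_ h] e] := root_sq Br x.
rewrite -(ripnr ipN) {1}cx (root_sym Br) -cbx.
rewrite (sa_sym D_sa Dx h) -(ripnr ipN (B x)) (root_sym Br) -ripDr addrC e.
by rewrite (ripnr ipN).
Qed.

Lemma nr_F_le x : dom D x -> nr (D (B x)) <= nr x.
Proof.
move=> Dx; rewrite -(@ler_pXn2r _ 2) ?nnegrE ?nr_ge0 //.
by rewrite -(nr_F_dom Dx) lerDl sqr_ge0.
Qed.

(** The specification puts only [B (B y)] in the domain. On the dense domain [D B] is a contraction,
    so closedness of [D] extends it to all [y]. *)
Lemma dom_B y : dom D (B y).
Proof.
have ex (n : nat) : exists v, dom D v /\ nr (v - y) < n.+1%:R^-1.
  have n0 : 0 < n.+1%:R^-1 :> R by rewrite invr_gt0.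
  have [v Dv hv] := sa_dense D_sa y n0.
  by exists v; rewrite nrB.
have [v hv] := choice ex.
have dDB m n : nr (D (B (v m)) - D (B (v n))) <= nr (v m - v n).
  have [Dm _] := hv m; have [Dn _] := hv n.
  have [Dbm _] := comm_B Dm; have [Dbn _] := comm_B Dn.
  by rewrite -appB // -(linB (root_linear Br)) nr_F_le //; apply: domB.
have [p hp] : exists l, forall e : R, 0 < e -> exists N, forall n, (N <= n)%N ->
    nr (D (B (v n)) - l) < e.
  apply: nr_cauchy => e e0.
  have [N hN] := inv_natS_lt (divr_gt0 e0 (ltr0n R 2)).
  exists N => m n Nm Nn; apply: le_lt_trans (dDB m n) _.
  apply: le_lt_trans (nr_tri _ y _) _; rewrite (nrB y).
  move: (hN m Nm) (hN n Nn) (hv m).2 (hv n).2.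
  move: m.+1%:R^-1 n.+1%:R^-1 => i j; lra.
suff [] : dom D (B y) /\ D (B y) = p by [].
apply: (sa_closed ipN D_sa) => e e0.
have [N1 h1] := hp e e0; have [N2 h2] := inv_natS_lt e0.
pose n := maxn N1 N2; have [Dn hn] := hv n.
exists (B (v n)); split; first exact: (comm_B Dn).1.
  rewrite -(linB (root_linear Br)); apply: le_trans (root_nr Br _) _.
  by apply: ltW (lt_trans hn _); apply: h2; rewrite leq_maxr.
by rewrite ltW // h1 // leq_maxl.
Qed.

Lemma F_linear : linear F.
Proof.
by move=> a x y; rewrite /vartheta /= (root_linear Br) app_linear //; apply: dom_B.
Qed.

Lemma F_dom x : dom D x -> F x = B (D x).
Proof. by move=> /comm_B[]. Qed.

Lemma dom_F x : dom D x -> dom D (F x).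
Proof. by move=> Dx; rewrite F_dom //; exact: dom_B. Qed.

Lemma F_sym_dom z w : dom D w -> rip (F z) w = rip z (F w).
Proof. by move=> Dw; rewrite (sa_sym D_sa (dom_B z) Dw) (root_sym Br) -F_dom. Qed.

(** Replace one factor of [rip (F y) (F y)] by a nearby [w] in the domain and move [F] onto it,
    where the bound is known. *)
Lemma nr_F y : nr (F y) <= nr y.
Proof.
have h : nr (F y) ^+ 2 - nr y * nr (F y) <= 0.
  apply: (@le_scaled_all _ _ (nr y + nr (F y))) => e e0.
  have [w Dw hw] := sa_dense D_sa (F y) e0.
  have h1 := le_trans (ler_norm _) (rip_le ipN y (F w)).
  have h2 := le_trans (ler_norm _) (rip_le ipN (F y) (F y - w)).
  have h3 := ler_wpM2l (nr_ge0 y) (nr_F_le Dw).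
  have h4 := ler_wpM2l (nr_ge0 (F y)) (ltW hw).
  have := nr_tri w (F y) 0; rewrite !subr0 (nrB w) => h5.
  have := ler_wpM2l (nr_ge0 y) h5; have := ler_wpM2l (nr_ge0 y) (ltW hw).
  move: h2; rewrite ripBr (ripnr ipN) F_sym_dom //; rewrite /vartheta /= in h3 *; lra.
have [-> | n0] := eqVneq (nr (F y)) 0; first exact: nr_ge0.
have np : 0 < nr (F y) by rewrite lt_def n0 nr_ge0.
by move: h; rewrite expr2 -mulrBl pmulr_lle0 // subr_le0.
Qed.

Lemma F_sym x y : rip (F x) y = rip x (F y).
Proof.
apply: (@eqr_scaled _ _ _ (2 * nr x)) => e e0.
have [w Dw hw] := sa_dense D_sa y e0.
have -> : rip (F x) y - rip x (F y) = rip (F x) (y - w) - rip x (F (y - w)).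
  by rewrite (linB F_linear) !ripBr (F_sym_dom x Dw); ring.
have h1 := rip_le ipN (F x) (y - w); have h2 := rip_le ipN x (F (y - w)).
have h3 := ler_wpM2r (nr_ge0 (y - w)) (nr_F x).
have h4 := ler_wpM2l (nr_ge0 x) (nr_F (y - w)).
have h5 := ler_wpM2l (nr_ge0 x) (ltW hw).
by apply: le_trans (ler_normB _ _) _; lra.
Qed.

Lemma B_absq x : dom D x -> B (S x) = x.
Proof.
move=> Dx; have [[h1 h2] e] := root_sq Br x.
rewrite /absq (linD (root_linear Br)) -[RHS]e; congr (_ + _).
rewrite -F_dom; last exact: dom_B.
rewrite /vartheta /=.
have [Dbx cx] := comm_B Dx; have [_ cbx] := comm_B Dbx.
by rewrite cbx cx.
Qed.

Lemma B_inj y z : B y = B z -> y = z.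
Proof.
move=> h; have [_ <-] := root_sq Br y; have [_ <-] := root_sq Br z.
by rewrite h.
Qed.

Lemma absq_B y : S (B y) = y.
Proof. by apply: B_inj; rewrite B_absq //; exact: dom_B. Qed.

Lemma F_absq x : dom D x -> F (S x) = D x.
Proof. by move=> Dx; rewrite /vartheta /= B_absq. Qed.

Lemma absq_F x : dom D x -> S (F x) = D x.
Proof. by move=> Dx; rewrite F_dom // absq_B. Qed.

Lemma absq_linear a x y : dom D x -> dom D y -> S (a *: x + y) = a *: S x + S y.
Proof.
move=> Dx Dy; rewrite /absq app_linear // F_linear (root_linear Br).
by rewrite scalerDr addrACA.
Qed.

Lemma absqB x y : dom D x -> dom D y -> S (x - y) = S x - S y.
Proof.
by move=> Dx Dy; rewrite addrC -scaleN1r absq_linear // scaleN1r addrC.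
Qed.

Lemma absq0 : S 0 = 0.
Proof. by rewrite /absq app0 (lin0 F_linear) (lin0 (root_linear Br)) addr0. Qed.

Lemma absqZ a x : dom D x -> S (a *: x) = a *: S x.
Proof.
by move=> Dx; have := absq_linear a Dx (dom0 D); rewrite absq0 !addr0.
Qed.

Lemma qformZ (a : R) x : dom D x ->
  qform (a%:C *: x) (a%:C *: x) = a ^+ 2 * qform x x.
Proof. by move=> Dx; rewrite /qform absqZ // ripZl ripZr mulrA expr2. Qed.

Lemma absq_sym x y : dom D x -> dom D y -> rip (S x) y = rip x (S y).
Proof.
by move=> Dx Dy; rewrite -{1}(B_absq Dy) -(root_sym Br) B_absq.
Qed.

Lemma nr_absq x : dom D x -> nr (S x) ^+ 2 = nr x ^+ 2 + nr (D x) ^+ 2.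
Proof.
move=> Dx; rewrite -(ripnr ipN) {2}/absq ripDr -(root_sym Br) (B_absq Dx).
by rewrite -F_sym F_absq // !(ripnr ipN).
Qed.

Lemma qform_sym : symform (dom D) qform.
Proof.
split=> [a x y z Dx Dy Dz|x y Dx Dy]; last by rewrite /qform absq_sym // ripC.
by rewrite /qform absq_linear // ripPl.
Qed.

Lemma qformC x y : dom D x -> dom D y -> qform x y = qform y x.
Proof. by move: x y; exact: qform_sym.2. Qed.

Lemma qform_ge0 x : dom D x -> 0 <= qform x x.
Proof.
by move=> Dx; rewrite /qform -{2}(B_absq Dx) ripC (root_pos Br).
Qed.

Lemma Bform_sym : symform (classical_sets.setT : set H) (fun x y => rip (B x) y).
Proof.
split=> [a u v w|u v] *; last by rewrite (root_sym Br) ripC.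
by rewrite (root_linear Br) ripPl.
Qed.

(** [S >= 1] follows from [B <= 1] by Cauchy-Schwarz for the form of [B], between [S x] and [x]. *)
Lemma qform_ge_nr x : dom D x -> nr x ^+ 2 <= qform x x.
Proof.
move=> Dx; pose y := S x.
have := form_cs2 (W := classical_sets.setT) (fun _ _ _ _ _ => I) Bform_sym
  (fun z _ => root_pos Br z) (x := y) (z := x) I I.
rewrite B_absq // (ripnr ipN) => h.
have hB : rip (B x) x <= nr x ^+ 2.
  apply: le_trans (le_trans (ler_norm _) (rip_le ipN _ _)) _.
  by rewrite expr2 ler_wpM2r ?nr_ge0 ?(root_nr Br).
have hq := qform_ge0 Dx; rewrite /qform -/y ripC in hq *.
have [x0|x0] := eqVneq (nr x) 0; first by rewrite x0 expr0n.
have xp : 0 < nr x ^+ 2 by rewrite exprn_gt0 // lt_def x0 nr_ge0.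
rewrite -(ler_pM2r xp) -expr2; apply: le_trans h _; exact: ler_wpM2l.
Qed.

Lemma qform_B_le x : dom D x -> qform (B x) (B x) <= qform x x.
Proof.
move=> Dx; rewrite {1}/qform absq_B; apply: le_trans (qform_ge_nr Dx).
apply: le_trans (le_trans (ler_norm _) (rip_le ipN _ _)) _.
by rewrite expr2 ler_wpM2l ?nr_ge0 ?(root_nr Br).
Qed.

Lemma absqE x : dom D x -> S x = B x + D (F x).
Proof. by move=> Dx; rewrite F_dom. Qed.

(** [S F = D] and [D F = S - B], so the two sides differ by the nonnegative [rip x (B x)]. *)
Lemma qform_F_le x : dom D x -> qform (F x) (F x) <= qform x x.
Proof.
move=> Dx; rewrite {1}/qform absq_F // (sa_sym D_sa Dx); last exact: dom_F.
have -> : D (F x) = S x - B x by rewrite absqE // addrC addKr.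
rewrite ripBr -absq_sym // -/(qform x x) lerBlDr lerDl.
by rewrite ripC (root_pos Br).
Qed.

Lemma sqrt_1sqE x : dom D x -> sqrt_1sq ip D x = S x.
Proof.
move=> Dx; apply: B_inj; rewrite (B_absq Dx) /sqrt_1sq.
have : [set y | B y = x] (get [set y | B y = x]).
  by apply: getPex; exists (S x); exact: B_absq.
by [].
Qed.

Lemma sqrt_1sq_B y : sqrt_1sq ip D (B y) = y.
Proof. by rewrite sqrt_1sqE ?absq_B //; exact: dom_B. Qed.

End BoundedTransform.

(** * Relatively bounded perturbations *)

Section Perturbation.
Variables (R : realType) (H : completeNormedModType R[i]).
Variables (ip : {dot H for Num.conj}).
Hypothesis ipN : induces_norm ip.
Local Notation rip := (rip ip).

Definition qnr (D : unbounded_op H) (x : H) : R := Num.sqrt (qform ip D x x).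

Lemma qnr_ge0 D x : 0 <= qnr D x.
Proof. exact: sqrtr_ge0. Qed.

Lemma qnr_sq D x : self_adjoint ip D -> dom D x -> qnr D x ^+ 2 = qform ip D x x.
Proof. by move=> D_sa Dx; rewrite /qnr sqr_sqrtr ?qform_ge0. Qed.

Lemma qnr_F D x : self_adjoint ip D -> dom D x -> qnr D (vartheta ip D x) <= qnr D x.
Proof. by move=> D_sa Dx; apply: ler_wsqrtr; exact: qform_F_le. Qed.

Lemma qnr_B D x : self_adjoint ip D -> dom D x -> qnr D (inv_sqrt_1sq ip D x) <= qnr D x.
Proof. by move=> D_sa Dx; apply: ler_wsqrtr; exact: qform_B_le. Qed.

Lemma nr_sa_i D x : self_adjoint ip D -> dom D x ->
  nr (D x + 'i *: x) ^+ 2 = nr (D x) ^+ 2 + nr x ^+ 2.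
Proof.
move=> D_sa Dx; rewrite -!(ripnr ipN) !ripE (ripC _ _ (D x)).
have ii : rip ('i *: x) ('i *: x) = rip x x.
  by rewrite rip_i scalerA -expr2 sqr_i scaleN1r ripNr opprK.
have : rip (D x) ('i *: x) = - rip (D x) ('i *: x).
  by rewrite {1}(sa_sym D_sa Dx (domZ _ Dx)) appZ // -[RHS]opprK -rip_i ripC opprK.
by rewrite ii; lra.
Qed.

Lemma qform_cs D x z : self_adjoint ip D -> dom D x -> dom D z ->
  `|qform ip D x z| <= qnr D x * qnr D z.
Proof.
move=> D_sa; apply: form_cs; [exact: dom_linset | exact: qform_sym |].
by move=> y; exact: qform_ge0.
Qed.

Section BoundedForms.
Variable D : unbounded_op H.
Hypothesis D_sa : self_adjoint ip D.
Local Notation B := (inv_sqrt_1sq ip D).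
Let Br := inv_sqrt_spec ipN D_sa.

(** The form of [B] is dominated by the Hilbert norm, so [krein] applies. Its value at [S x] is [q]
    at [x]: with [K = E B] this yields the relative form bounds below. *)
Lemma Bform_krein (K : H -> H) c : 0 <= c ->
  (forall u v, rip (B (K u)) v = rip (B u) (K v)) ->
  (forall u, nr (K u) <= c * nr u) ->
  forall y, rip (B (K y)) (K y) <= c ^+ 2 * rip (B y) y.
Proof.
move=> c0 sK nK y.
apply: (krein (W := classical_sets.setT) (b := fun y z => rip (B y) z)
    (N := fun z => nr z ^+ 2) (fun _ _ _ _ _ => I) (Bform_sym ipN D_sa)) => //.
- by move=> u _; exact: root_pos Br u.
- move=> u _; apply: le_trans (le_trans (ler_norm _) (rip_le ipN _ _)) _.
  by rewrite expr2 ler_wpM2r ?nr_ge0 ?(root_nr Br).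
- exact: sqr_ge0.
- by move=> u _; rewrite -exprMn lerXn2r ?nnegrE ?nr_ge0 ?mulr_ge0 ?nr_ge0.
Qed.

Lemma Bform_krein_diag (K : H -> H) c : 0 <= c ->
  (forall u v, rip (B (K u)) v = rip (B u) (K v)) ->
  (forall u, nr (K u) <= c * nr u) ->
  forall y, `|rip (B y) (K y)| <= c * rip (B y) y.
Proof.
move=> c0 sK nK y; have b0 z := root_pos Br z.
have h := form_cs (W := classical_sets.setT) (fun _ _ _ _ _ => I)
  (Bform_sym ipN D_sa) (fun z _ => b0 z) (x := y) (z := K y) I I.
apply: le_trans h _; have m1 := Bform_krein c0 sK nK y.
have -> : c * rip (B y) y = Num.sqrt (rip (B y) y) * Num.sqrt (c ^+ 2 * rip (B y) y).
  by rewrite sqrtrM ?sqr_ge0 // sqrtr_sqr (ger0_norm c0) mulrCA -expr2 sqr_sqrtr ?b0.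
by rewrite ler_wpM2l ?sqrtr_ge0 // ler_wsqrtr.
Qed.

Variables (E : H -> H) (c : R).
Hypothesis c0 : 0 <= c.
Hypothesis sE : forall x y, dom D x -> dom D y -> rip (E x) y = rip x (E y).
Hypothesis nE : forall x, dom D x -> nr (E x) <= c * nr (absq ip D x).

Let EB_sym u v : rip (B (E (B u))) v = rip (B u) (E (B v)).
Proof. by rewrite (root_sym Br) sE //; exact: dom_B. Qed.

Let EB_nr u : nr (E (B u)) <= c * nr u.
Proof. by have := nE (dom_B ipN D_sa u); rewrite absq_B. Qed.

Lemma qnr_BE x : dom D x -> qnr D (B (E x)) <= c * qnr D x.
Proof.
move=> Dx; have := Bform_krein c0 EB_sym EB_nr (absq ip D x).
rewrite B_absq // => h.
rewrite -(@ler_pXn2r _ 2) ?nnegrE ?mulr_ge0 ?qnr_ge0 // exprMn !qnr_sq //; last exact: dom_B.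
by rewrite /qform absq_B // ripC (ripC _ (absq ip D x)).
Qed.

Lemma qform_bound x : dom D x -> `|rip (E x) x| <= c * qform ip D x x.
Proof.
move=> Dx; have := Bform_krein_diag c0 EB_sym EB_nr (absq ip D x).
by rewrite B_absq // ripC /qform (ripC _ (absq _ _ _)).
Qed.
End BoundedForms.

Section Pair.
Variables D1 D2 : unbounded_op H.
Hypotheses (sa1 : self_adjoint ip D1) (sa2 : self_adjoint ip D2).
Hypothesis dom12 : dom D2 `<=` dom D1.
Variable k : R.
Hypotheses (k0 : 0 <= k) (k1 : k < 1).
Hypothesis Vk : forall x, dom D2 x -> nr (D1 x - D2 x) <= k * nr (absq ip D2 x).

Local Notation S1 := (absq ip D1).
Local Notation S2 := (absq ip D2).
Local Notation B2 := (inv_sqrt_1sq ip D2).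

(* Kato-Rellich: [D1 + i] already maps the domain of D2 onto the whole space. *)
Lemma dom_perturbed : dom D1 = dom D2.
Proof.
apply/seteqP; split=> // z Dz.
have Br := inv_sqrt_spec ipN sa2; have lB := root_linear Br.
(* The resolvent [(D2 + i)^-1 = (D2 - i) (1 + D2^2)^-1]; [S2 J] is isometric because
   [|S2 x| = |(D2 + i) x|]. *)
pose J g := D2 (B2 (B2 g)) - 'i *: B2 (B2 g).
have J2 g : dom D2 (J g).
  by have [[h1 h2] _] := root_sq Br g; apply: domB => //; apply: domZ.
have JE g : D2 (J g) + 'i *: J g = g.
  have [[h1 h2] e] := root_sq Br g; rewrite /J appB ?appZ //; last exact: domZ.
  by rewrite scalerBr scalerA -expr2 sqr_i scaleN1r opprK addrA subrK addrC.
have JN g : nr (S2 (J g)) = nr g.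
  apply/eqP; rewrite -(@eqrXn2 _ 2) ?nr_ge0 //.
  by rewrite nr_absq // addrC -nr_sa_i // JE.
have JB g g' : J (g - g') = J g - J g'.
  rewrite /J !(linB lB) appB; last 2 first; try exact: dom_B.
  rewrite scalerBr; apply: (rip_ext ipN) => w; rewrite !ripE; ring.
pose T g := D1 (J g) - D2 (J g).
have TB g g' : nr (T g - T g') <= k * nr (g - g').
  have VB x y : dom D2 x -> dom D2 y ->
      D1 (x - y) - D2 (x - y) = (D1 x - D2 x) - (D1 y - D2 y).
    move=> Dx Dy; rewrite !appB //; try exact: dom12.
    by apply: (rip_ext ipN) => w; rewrite !ripE; ring.
  by have := Vk (J2 (g - g')); rewrite JN JB (VB _ _ (J2 g) (J2 g')).
(* Picard iteration for [g = f - T g], a contraction of ratio [k]; its fixed point satisfies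
   [(D1 + i) (J g) = f]. *)
pose f := D1 z + 'i *: z.
pose u n := iter n (fun g => f - T g) 0.
have uS n : u n.+1 = f - T (u n) by [].
have step m n : nr (u m.+1 - u n.+1) <= k * nr (u m - u n).
  apply: le_trans (TB _ _); rewrite !uS nrB.
  have -> // : f - T (u n) - (f - T (u m)) = T (u m) - T (u n).
  by apply: (rip_ext ipN) => w; rewrite !ripE; ring.
pose C := nr (u 1%N - u 0%N) / (1 - k).
have k1' : 0 < 1 - k by rewrite subr_gt0.
have C0 : 0 <= C by rewrite divr_ge0 ?nr_ge0 ?ltW.
have uC m : nr (u m - u 0%N) <= C.
  elim: m => [|m IH]; first by rewrite subrr nr0.
  apply: le_trans (nr_tri _ (u 1%N) _) _.
  have e : nr (u 1%N - u 0%N) = (1 - k) * C by rewrite /C mulrC divfK ?gt_eqF.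
  by have := step m 0%N; have := ler_wpM2l k0 IH; lra.
have ukC n j : nr (u (n + j)%N - u n) <= k ^+ n * C.
  elim: n => [|n IH]; first by rewrite expr0 mul1r.
  by apply: le_trans (step _ _) _; rewrite exprS -mulrA ler_wpM2l.
have [g hg] : exists l, forall e : R, 0 < e -> exists N, forall n, (N <= n)%N -> nr (u n - l) < e.
  apply: nr_cauchy => e e0.
  have [N hN] : exists N, k ^+ N * C < e / 2.
    have ck : (k ^+ n * C) @[n --> \oo] --> 0 * C.
      by apply: cvgMl; apply: cvg_expr; rewrite ger0_norm.
    move/cvgrPdist_lt : ck => /(_ _ (divr_gt0 e0 (ltr0n R 2))) [N _ hN].
    exists N; have := hN N (leqnn N); rewrite /= mul0r sub0r normrN.
    by apply: le_lt_trans; exact: ler_norm.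
  exists N => m n Nm Nn; apply: le_lt_trans (nr_tri _ (u N) _) _.
  rewrite (nrB (u N)) -(subnKC Nm) -(subnKC Nn).
  by have := ukC N (m - N)%N; have := ukC N (n - N)%N; lra.
have ge : g = f - T g.
  apply: (@eq_scaled _ _ _ _ 2) => e e0; have [N hN] := hg e e0.
  apply: le_trans (nr_tri _ (u N.+1) _) _.
  have := hN N.+1 (leqnSn N); have := hN N (leqnn N).
  have -> : u N.+1 - (f - T g) = T g - T (u N).
    by rewrite uS; apply: (rip_ext ipN) => w; rewrite !ripE; ring.
  rewrite (nrB g); have := TB g (u N); have := nr_ge0 (g - u N); rewrite (nrB g (u N)); nra.
have D1J := dom12 (J2 g).
(* [D1 + i] is injective, hence [z = J g] lies in the domain of [D2]. *)
have e0 : D1 (z - J g) + 'i *: (z - J g) = 0.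
  rewrite appB // scalerBr.
  have -> : D1 z - D1 (J g) + ('i *: z - 'i *: J g) = f - T g - (D2 (J g) + 'i *: J g).
    by rewrite /f /T; apply: (rip_ext ipN) => w; rewrite !ripE; ring.
  by rewrite JE -ge subrr.
have := nr_sa_i sa1 (domB Dz D1J); rewrite e0 nr0 expr0n /= => /esym/eqP.
rewrite paddr_eq0 ?sqr_ge0 // => /andP[_]; rewrite sqrf_eq0 => /eqP/nr0_eq0/subr0_eq ->.
exact: J2.
Qed.

End Pair.
End Perturbation.

(** * Comparison of q, B and F for two nearby operators *)

Section SmallPerturbation.
Variables (R : realType) (H : completeNormedModType R[i]).
Variables (ip : {dot H for Num.conj}).
Hypothesis ipN : induces_norm ip.
Local Notation rip := (rip ip).
Local Notation qform := (qform ip).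
Local Notation qnr := (qnr ip).

Variables D1 D2 : unbounded_op H.
Hypotheses (sa1 : self_adjoint ip D1) (sa2 : self_adjoint ip D2).
Hypothesis domE : dom D1 = dom D2.
Variable k : R.
Hypotheses (k0 : 0 <= k) (k2 : k <= 2^-1).
Hypothesis Vk : forall x, dom D2 x -> nr (D1 x - D2 x) <= k * nr (absq ip D2 x).

Local Notation S1 := (absq ip D1).
Local Notation S2 := (absq ip D2).
Local Notation B1 := (inv_sqrt_1sq ip D1).
Local Notation B2 := (inv_sqrt_1sq ip D2).
Local Notation F1 := (vartheta ip D1).
Local Notation F2 := (vartheta ip D2).

Let dom21 x : dom D2 x -> dom D1 x. Proof. by rewrite domE. Qed.

Lemma nr_le_absq D x : self_adjoint ip D -> dom D x -> nr (D x) <= nr (absq ip D x).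
Proof.
move=> D_sa Dx; rewrite -(@ler_pXn2r _ 2) ?nnegrE ?nr_ge0 //.
by rewrite nr_absq // lerDr sqr_ge0.
Qed.

(** The function [sqrt (|x|^2 + t^2)] is 1-Lipschitz in [t]. *)
Lemma absq_pair_le D D' x c : self_adjoint ip D -> self_adjoint ip D' ->
  dom D x -> dom D' x -> 0 <= c -> nr (D x) <= nr (D' x) + c ->
  nr (absq ip D x) <= nr (absq ip D' x) + c.
Proof.
move=> D_sa D'_sa Dx D'x c0 h.
have h0 := nr_ge0 (absq ip D' x).
rewrite -(@ler_pXn2r _ 2) ?nnegrE ?nr_ge0 ?addr_ge0 //.
rewrite nr_absq // sqrrD nr_absq //.
have h1 := nr_le_absq D'_sa D'x.
have h2 : nr (D x) ^+ 2 <= (nr (D' x) + c) ^+ 2.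
  by rewrite lerXn2r ?nnegrE ?addr_ge0 ?nr_ge0.
have := ler_wpM2r c0 h1; move: h2; rewrite sqrrD; lra.
Qed.

Lemma absq_ratio x : dom D2 x ->
  nr (S1 x) <= (1 + k) * nr (S2 x) /\ (1 - k) * nr (S2 x) <= nr (S1 x).
Proof.
move=> Dx; have kS : 0 <= k * nr (S2 x) by rewrite mulr_ge0 ?nr_ge0.
have h1 : nr (D1 x) <= nr (D2 x) + k * nr (S2 x).
  have := nr_tri (D1 x) (D2 x) 0; rewrite !subr0; have := Vk Dx; lra.
have h2 : nr (D2 x) <= nr (D1 x) + k * nr (S2 x).
  have := nr_tri (D2 x) (D1 x) 0; rewrite !subr0 (nrB (D2 x)); have := Vk Dx; lra.
have := absq_pair_le sa1 sa2 (dom21 Dx) Dx kS h1.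
have := absq_pair_le sa2 sa1 Dx (dom21 Dx) kS h2; lra.
Qed.

Let k_lt1 : k < 1. Proof. move: k2; lra. Qed.

(** Heinz's inequality: the two-sided comparison of [|S1 x|] with [|S2 x|] passes to the forms with
    the same constants, by applying [qform_bound] to [S1] relative to [D2] and to [S2] relative to
    [D1]. *)
Lemma qform_ratio x : dom D2 x -> `|qform D1 x x - qform D2 x x| <= k * qform D2 x x.
Proof.
move=> Dx; have k1' : 0 < 1 - k by rewrite subr_gt0 k_lt1.
have h1 := qform_bound (E := S1) (c := 1 + k) ipN sa2 (addr_ge0 ler01 k0) _ _ (x := x).
have h2 := qform_bound (E := S2) (c := (1 - k)^-1) ipN sa1 _ _ _ (x := x).
rewrite ler_norml; apply/andP; split.
  have : `|rip (S2 x) x| <= (1 - k)^-1 * qform D1 x x.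
    apply: h2; first by rewrite invr_ge0 ltW.
    - by rewrite domE => u v; exact: absq_sym.
    - rewrite domE => u Du; rewrite mulrC ler_pdivlMr // mulrC.
      by have [] := absq_ratio Du.
    - exact: dom21.
  rewrite ger0_norm; last exact: qform_ge0.
  rewrite mulrC ler_pdivlMr // -/(qform D2 x x); lra.
have : `|rip (S1 x) x| <= (1 + k) * qform D2 x x.
  apply: h1 => //; first by rewrite -domE => u v; exact: absq_sym.
  by move=> u Du; have [] := absq_ratio Du.
by rewrite ger0_norm; [rewrite -/(qform D1 x x); lra | apply: qform_ge0 => //; exact: dom21].
Qed.

Lemma qform_cross x z : dom D2 x -> dom D2 z ->
  `|qform D1 x z - qform D2 x z| <= k * qnr D2 x * qnr D2 z.
Proof.
apply: (form_bound (e := fun x z => qform D1 x z - qform D2 x z) (W := dom D2)) => //.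
- exact: dom_linset.
- have := qform_sym ipN sa1; have := qform_sym ipN sa2; rewrite domE.
  move=> [l2 s2] [l1 s1]; split=> [a u v w Du Dv Dw|u v Du Dv].
    by rewrite l1 // l2 //; ring.
  by rewrite s1 // s2.
- exact: qform_sym.
- by move=> u Du; exact: qform_ge0.
- exact: qform_ratio.
Qed.

Lemma V_cross x z : dom D2 x -> dom D2 z ->
  `|rip (D1 x - D2 x) z| <= k * qnr D2 x * qnr D2 z.
Proof.
have sV u v : dom D2 u -> dom D2 v -> rip (D1 u - D2 u) v = rip u (D1 v - D2 v).
  move=> Du Dv; rewrite ripBl ripBr (sa_sym sa2 Du Dv).
  by rewrite (sa_sym sa1 (dom21 Du) (dom21 Dv)).
apply: (form_bound (e := fun x z => rip (D1 x - D2 x) z) (W := dom D2)) => //.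
- exact: dom_linset.
- split=> [a u v w Du Dv Dw|u v Du Dv]; last by rewrite sV // ripC.
  by rewrite !app_linear //; try exact: dom21; rewrite !ripE; ring.
- exact: qform_sym.
- by move=> u Du; exact: qform_ge0.
- exact: qform_bound.
Qed.

(** Coercivity: [k <= 1/2] gives [q1 >= q2 / 2], so differences can be estimated by testing [S1 g]
    against [g] itself. *)
Lemma qnr_le_of g c : dom D2 g -> 0 <= c ->
  qform D1 g g <= c * qnr D2 g -> qnr D2 g <= 2 * c.
Proof.
move=> Dg c0 h; have h1 := qform_ratio Dg; have q0 := qform_ge0 ipN sa2 Dg.
move: h1; rewrite ler_norml => /andP[h1 _].
have h2 := ler_wpM2r q0 k2; have := qnr_sq ipN sa2 Dg.
have [-> |n0] := eqVneq (qnr D2 g) 0; first by move=> _; lra.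
have np : 0 < qnr D2 g by rewrite lt_def n0 qnr_ge0.
move=> e; rewrite -(ler_pM2r np) -expr2 e; lra.
Qed.

(** [S1 B1 x = x = S2 B2 x], so [S1] applied to the difference leaves only [q1 - q2] evaluated at
    [B2 x]. *)
Lemma qnr_B_diff x : dom D2 x -> qnr D2 (B1 x - B2 x) <= 2 * k * qnr D2 x.
Proof.
move=> Dx; have DB2 := dom_B ipN sa2 x; have DB1 : dom D2 (B1 x).
  by rewrite -domE; exact: dom_B.
have Dg := domB DB1 DB2; rewrite -mulrA; apply: qnr_le_of => //.
  by rewrite mulr_ge0 ?qnr_ge0.
set g := B1 x - B2 x in Dg *.
have -> : qform D1 g g = - (qform D1 (B2 x) g - qform D2 (B2 x) g).
  rewrite {1}/qform {1}/g absqB //; try exact: dom21.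
  by rewrite absq_B // ripBl /qform absq_B //; ring.
apply: le_trans (ler_norm _) _; rewrite normrN.
apply: le_trans (qform_cross DB2 Dg) _.
by rewrite ler_wpM2r ?qnr_ge0 // ler_wpM2l // qnr_B.
Qed.

(** Now [S1 F1 = D1] and [S2 F2 = D2]: the perturbation and the change of form each contribute [k],
    doubled by coercivity. *)
Lemma qnr_F_diff x : dom D2 x -> qnr D2 (F1 x - F2 x) <= 4 * k * qnr D2 x.
Proof.
move=> Dx; have DF2 := dom_F ipN sa2 Dx; have DF1 : dom D2 (F1 x).
  by rewrite -domE; apply: dom_F => //; exact: dom21.
have Dg := domB DF1 DF2.
have -> : 4 * k * qnr D2 x = 2 * (2 * k * qnr D2 x) by ring.
apply: qnr_le_of => //; first by rewrite !mulr_ge0 ?qnr_ge0.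
set g := F1 x - F2 x in Dg *.
have -> : qform D1 g g = rip (D1 x - D2 x) g - (qform D1 (F2 x) g - qform D2 (F2 x) g).
  rewrite {1}/qform {1}/g absqB //; try exact: dom21.
  rewrite (absq_F ipN sa1 (dom21 Dx)) !ripBl /qform (absq_F ipN sa2 Dx); ring.
apply: le_trans (ler_norm _) _; apply: le_trans (ler_normB _ _) _.
have h1 := qform_cross DF2 Dg; have h2 := V_cross Dx Dg.
have := ler_wpM2r (qnr_ge0 ip D2 g) (ler_wpM2l k0 (qnr_F ipN sa2 Dx)); lra.
Qed.

(** Expand [S1 F2] and [F1 S2] with [S = B + D F]: the parts in [D F] give [- F1 V F2], and
    [F1 B2 - B1 F2 = B1 V B2]. *)
Lemma sylvester x z : dom D2 x -> dom D2 z ->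
  rip (F1 x - F2 x) (S1 z) + rip (F1 (S2 x) - F2 (S2 x)) z =
  rip (D1 x - D2 x) z + rip (D1 (B2 x) - D2 (B2 x)) (B1 z)
   - rip (D1 (F2 x) - D2 (F2 x)) (F1 z).
Proof.
move=> Dx Dz; have D1x := dom21 Dx; have D1z := dom21 Dz.
have DF2 := dom_F ipN sa2 Dx; have D1F2 := dom21 DF2.
have DB2 := dom_B ipN sa2 x; have D1B2 := dom21 DB2.
have DB1 := dom_B ipN sa1 z; have DF1 := dom_F ipN sa1 D1z.
rewrite !ripBl (F_absq ipN sa2 Dx).
rewrite -(absq_sym ipN sa1 (dom_F ipN sa1 D1x) D1z) (absq_F ipN sa1 D1x).
rewrite (absqE ipN sa2 Dx) (absqE ipN sa1 D1z) (linD (F_linear ipN sa1)) !ripE.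
rewrite (F_sym ipN sa1 (D2 (F2 x))) (F_sym ipN sa1 (B2 x)).
rewrite -(sa_sym sa1 D1F2 DF1) (sa_sym sa1 D1B2 DB1).
have -> : D2 (B2 x) = F2 x by [].
have -> : D1 (B1 z) = F1 z by [].
ring.
Qed.

End SmallPerturbation.

(** * Difference quotients *)

Section DifferenceQuotient.
Variables (R : realType) (H : completeNormedModType R[i]).
Variables (ip : {dot H for Num.conj}).
Hypothesis ipN : induces_norm ip.
Local Notation rip := (rip ip).
Local Notation qform := (qform ip).
Local Notation qnr := (qnr ip).
Local Notation B D := (inv_sqrt_1sq ip D).
Local Notation F D := (vartheta ip D).
Local Notation S D := (absq ip D).

(** The crude bound [L] serves as continuity; the sharp [c] spreads from [W] by density. *)
Lemma dense_bound (W : set H) (G : H -> H) (L c : R) : linear G -> dense_in W ->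
  0 <= c -> (forall x, nr (G x) <= L * nr x) ->
  (forall x, W x -> nr (G x) <= c * nr x) -> forall x, nr (G x) <= c * nr x.
Proof.
move=> lG dW c0 hL hc x; rewrite -subr_le0.
apply: (@le_scaled_all _ _ (`|L| + c)) => e e0.
have [w Ww hw] := dW x e e0.
have := nr_tri (G x) (G w) 0; rewrite !subr0 -(linB lG).
have h1 := hL (x - w); have h2 := hc w Ww.
have h3 := nr_tri w x 0; rewrite !subr0 (nrB w) in h3.
have h4 := ler_wpM2l c0 h3; have h5 := ler_wpM2l c0 (ltW hw).
have h6 := ler_wpM2r (nr_ge0 (x - w)) (ler_norm L).
have h7 := ler_wpM2l (normr_ge0 L) (ltW hw); lra.
Qed.

Lemma qform_subl D x y z : self_adjoint ip D -> dom D x -> dom D y ->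
  qform D (x - y) z = qform D x z - qform D y z.
Proof. by move=> D_sa Dx Dy; rewrite /qform absqB // ripBl. Qed.

Lemma qform_par D u v : self_adjoint ip D -> dom D u -> dom D v ->
  qform D (u - v) (u - v) <= 2 * (qform D u u + qform D v v).
Proof.
move=> D_sa Du Dv; have := qform_ge0 ipN D_sa (domD Du Dv).
have Dvn := domN Dv.
have -> : u + v = u - (- v) by rewrite opprK.
have e w : qform D (- v) w = - qform D v w.
  by rewrite /qform -scaleN1r absqZ // scaleN1r ripNl.
rewrite !qform_subl // !e /qform !ripBr !ripNr; lra.
Qed.

Definition bform (E : H -> H) (D : unbounded_op H) (c : R) :=
  forall x z, dom D x -> dom D z -> `|rip (E x) z| <= c * qnr D x * qnr D z.

Definition quot D1 D2 (r : R) (x : H) : H := r^-1%:C *: (F D1 x - F D2 x).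

Section QuotientFacts.
Variables (D1 D2 : unbounded_op H) (r : R).
Hypotheses (sa1 : self_adjoint ip D1) (sa2 : self_adjoint ip D2).

Lemma quot_linear : linear (quot D1 D2 r).
Proof.
move=> a x y; rewrite /quot (F_linear ipN sa1) (F_linear ipN sa2).
rewrite scalerA mulrC -scalerA -scalerDr; congr (_ *: _).
by rewrite scalerBr; apply: (rip_ext ipN) => z; rewrite !ripE; ring.
Qed.

Lemma quot_sym x y : rip (quot D1 D2 r x) y = rip x (quot D1 D2 r y).
Proof. by rewrite /quot !ripE (F_sym ipN sa1) (F_sym ipN sa2). Qed.

Lemma quot_nr x : nr (quot D1 D2 r x) <= 2 * `|r^-1| * nr x.
Proof.
rewrite /quot nrZ -[leRHS]mulrA mulrCA ler_wpM2l //.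
apply: le_trans (nrD _ _) _; rewrite nrN.
by have := nr_F ipN sa1 x; have := nr_F ipN sa2 x; lra.
Qed.

End QuotientFacts.

Section Base.
Variable D0 : unbounded_op H.
Hypothesis sa0 : self_adjoint ip D0.

(** [K] is a Lipschitz constant common to all pairs and [h] the closeness to the base point. The
    quotient of [D] is close to [E0] only as a form. *)
Record good_pair (E0 : H -> H) (K h : R) (D1 D2 : unbounded_op H) (r : R) : Prop := GoodPair {
  gp_sa1 : self_adjoint ip D1;
  gp_sa2 : self_adjoint ip D2;
  gp_dom1 : dom D1 = dom D0;
  gp_dom2 : dom D2 = dom D0;
  gp_r : r != 0;
  gp_rK : K * `|r| <= 2^-1;
  gp_near1 : forall x, dom D0 x -> nr (D1 x - D0 x) <= h * nr (S D0 x);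
  gp_near2 : forall x, dom D0 x -> nr (D2 x - D0 x) <= h * nr (S D0 x);
  gp_lip : forall x, dom D2 x -> nr (D1 x - D2 x) <= K * `|r| * nr (S D2 x);
  gp_quot : bform (fun x => r^-1%:C *: (D1 x - D2 x) - E0 x) D0 h }.

Variables (E0 : H -> H) (K h C : R).
Hypotheses (K0 : 0 <= K) (h0 : 0 <= h) (h2 : h <= 2^-1) (C0 : 0 <= C).
Hypothesis E0B : forall x y, dom D0 x -> dom D0 y -> E0 (x - y) = E0 x - E0 y.
Hypothesis E0C : bform E0 D0 C.

(* The right-hand side of the Sylvester equation of the derivative, as a form. *)
Definition source (x : H) : R :=
  rip (E0 x) x + rip (E0 (B D0 x)) (B D0 x) - rip (E0 (F D0 x)) (F D0 x).

Section OnePair.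
Variables (D1 D2 : unbounded_op H) (r : R).
Hypothesis gp : good_pair E0 K h D1 D2 r.
Let sa1 := gp_sa1 gp.
Let sa2 := gp_sa2 gp.

Lemma quot_dom x : dom D0 x -> dom D0 (quot D1 D2 r x).
Proof.
move=> Dx; apply: domZ; apply: domB.
  by rewrite -(gp_dom1 gp); apply: dom_F => //; rewrite (gp_dom1 gp).
by rewrite -(gp_dom2 gp); apply: dom_F => //; rewrite (gp_dom2 gp).
Qed.

Lemma qnr_equiv D x : self_adjoint ip D -> dom D = dom D0 ->
  (forall x, dom D0 x -> nr (D x - D0 x) <= h * nr (S D0 x)) -> dom D0 x ->
  qnr D x <= 2 * qnr D0 x /\ qnr D0 x <= 2 * qnr D x.
Proof.
move=> D_sa domD hD Dx.
have := qform_ratio ipN D_sa sa0 domD h0 h2 hD Dx; rewrite ler_norml => /andP[l1 l2].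
have Dx' : dom D x by rewrite domD.
have hq := ler_wpM2r (qform_ge0 ipN sa0 Dx) h2; have q0 := qform_ge0 ipN D_sa Dx'.
have q00 := qform_ge0 ipN sa0 Dx.
split; rewrite -(@ler_pXn2r _ 2) ?nnegrE ?mulr_ge0 ?qnr_ge0 // exprMn !(qnr_sq ipN) //.
all: lra.
Qed.

Let eq2 x (Dx : dom D0 x) := qnr_equiv sa2 (gp_dom2 gp) (gp_near2 gp) Dx.

(** [qnr_F_diff] gives [4 K] in the norm of [D2]; passing between the norms of [D2] and [D0] costs 2
    each way. *)
Lemma quot_qnr x : dom D0 x -> qnr D0 (quot D1 D2 r x) <= 16 * K * qnr D0 x.
Proof.
move=> Dx; have Dx2 : dom D2 x by rewrite (gp_dom2 gp).
have r0 : 0 < `|r| by rewrite normr_gt0 (gp_r gp).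
have dom12 : dom D1 = dom D2 by rewrite (gp_dom1 gp) (gp_dom2 gp).
have := qnr_F_diff ipN sa1 sa2 dom12 (mulr_ge0 K0 (ltW r0)) (gp_rK gp) (gp_lip gp) Dx2.
have e : F D1 x - F D2 x = r%:C *: quot D1 D2 r x.
  by rewrite /quot scalerA -rmorphM /= mulfV ?(gp_r gp) // scale1r.
have DX := quot_dom Dx; have DX2 : dom D2 (quot D1 D2 r x) by rewrite (gp_dom2 gp).
have -> : qnr D2 (F D1 x - F D2 x) = `|r| * qnr D2 (quot D1 D2 r x).
  rewrite e /qnr; set u := quot _ _ _ _ in DX2 *.
  rewrite (qformZ ipN sa2) //.
  by rewrite sqrtrM ?sqr_ge0 // sqrtr_sqr.
rewrite mulrA mulrAC mulrC ler_pM2r // => k1.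
have [_ k2] := eq2 DX; have [k3 _] := eq2 Dx.
by have := ler_wpM2l K0 k3; lra.
Qed.

(** Change [E], [u], [v] one at a time: 16 comes from two factors [4 p], and [5 = 4 + 1] from the
    other two changes. *)
Lemma cross_bound (E E' : H -> H) (u u' v v' : H) (c p : R) :
  bform (fun x => E x - E' x) D0 h -> bform E' D0 C ->
  (forall x y, dom D0 x -> dom D0 y -> E' (x - y) = E' x - E' y) ->
  dom D0 u -> dom D0 u' -> dom D0 v -> dom D0 v' -> 0 <= p -> 0 <= c ->
  qnr D0 u <= 4 * p -> qnr D0 v <= 4 * p -> qnr D0 u' <= p ->
  qnr D0 (u - u') <= c * h * p -> qnr D0 (v - v') <= c * h * p ->
  `|rip (E u) v - rip (E' u') v'| <= (16 + 5 * c * C) * h * p ^+ 2.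
Proof.
move=> hE hE' EB' Du Du' Dv Dv' p0 c0 pu pv pu' pd pd'.
have -> : rip (E u) v - rip (E' u') v' =
    rip (E u - E' u) v + (rip (E' (u - u')) v + rip (E' u') (v - v')).
  by rewrite EB' // !ripE; ring.
have pp D x := qnr_ge0 ip D x.
have chp : 0 <= c * h * p by rewrite !mulr_ge0.
have k1 : `|rip (E u - E' u) v| <= h * (4 * p) * (4 * p).
  apply: le_trans (hE _ _ Du Dv) _; apply: ler_pM; rewrite ?mulr_ge0 ?pp //.
  exact: ler_wpM2l.
have k2 : `|rip (E' (u - u')) v| <= C * (c * h * p) * (4 * p).
  apply: le_trans (hE' _ _ (domB Du Du') Dv) _; apply: ler_pM; rewrite ?mulr_ge0 ?pp //.
  exact: ler_wpM2l.
have k3 : `|rip (E' u') (v - v')| <= C * p * (c * h * p).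
  apply: le_trans (hE' _ _ Du' (domB Dv Dv')) _; apply: ler_pM; rewrite ?mulr_ge0 ?pp //.
  exact: ler_wpM2l.
apply: le_trans (ler_normD _ _) _; apply: le_trans (lerD (lexx _) (ler_normD _ _)) _.
lra.
Qed.

(** Freezing the Sylvester equation at [D0]: the two changes of form cost [16 K] each, the three
    source terms [1], [16 + 10 C] and [16 + 20 C]. *)
Lemma quot_sylvester x : dom D0 x ->
  `|2 * qform D0 x (quot D1 D2 r x) - source x| <=
    (33 + 32 * K + 30 * C) * h * qform D0 x x.
Proof.
move=> Dx; have Dx1 : dom D1 x by rewrite (gp_dom1 gp).
have Dx2 : dom D2 x by rewrite (gp_dom2 gp).
have dom12 : dom D1 = dom D2 by rewrite (gp_dom1 gp) (gp_dom2 gp).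
pose E x := r^-1%:C *: (D1 x - D2 x).
have syl := sylvester ipN sa1 sa2 dom12 Dx2 Dx2.
set X := quot D1 D2 r x; have DX : dom D0 X := quot_dom Dx.
have {}syl : qform D1 x X + qform D2 x X =
    rip (E x) x + rip (E (B D2 x)) (B D1 x) - rip (E (F D2 x)) (F D1 x).
  rewrite /qform (ripC _ (S D1 x)) -(quot_sym _ sa1 sa2 (S D2 x)).
  by rewrite /X /quot /E !ripZl -!mulrDr -mulrBr syl.
have c1 := qform_cross ipN sa1 sa0 (gp_dom1 gp) h0 h2 (gp_near1 gp) Dx DX.
have c2 := qform_cross ipN sa2 sa0 (gp_dom2 gp) h0 h2 (gp_near2 gp) Dx DX.
have p0 := qnr_ge0 ip D0 x.
have hX := ler_wpM2l (mulr_ge0 h0 p0) (quot_qnr Dx).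
have hq := qnr_sq ipN sa0 Dx.
have q := gp_quot gp.
have b1 : dom D0 (B D1 x) by rewrite -(gp_dom1 gp); exact: dom_B.
have b2 : dom D0 (B D2 x) by rewrite -(gp_dom2 gp); exact: dom_B.
have f1 : dom D0 (F D1 x) by rewrite -(gp_dom1 gp); exact: dom_F.
have f2 : dom D0 (F D2 x) by rewrite -(gp_dom2 gp); exact: dom_F.
have b0 := dom_B ipN sa0 x; have f0 := dom_F ipN sa0 Dx.
have four D y : self_adjoint ip D -> dom D = dom D0 ->
  (forall x, dom D0 x -> nr (D x - D0 x) <= h * nr (S D0 x)) -> dom D0 y ->
  qnr D y <= qnr D x -> qnr D0 y <= 4 * qnr D0 x.
  move=> D_sa dD nD Dy hy; have [_ k2] := qnr_equiv D_sa dD nD Dy.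
  by have [k1 _] := qnr_equiv D_sa dD nD Dx; lra.
have K1 : `|rip (E x) x - rip (E0 x) x| <= h * qnr D0 x ^+ 2.
  by have := q x x Dx Dx; rewrite ripBl expr2 mulrA.
have K2 := cross_bound (u := B D2 x) (u' := B D0 x) (v := B D1 x) (v' := B D0 x)
  (c := 2) q E0C E0B b2 b0 b1 b0 p0 (ler0n _ _).
have K3 := cross_bound (u := F D2 x) (u' := F D0 x) (v := F D1 x) (v' := F D0 x)
  (c := 4) q E0C E0B f2 f0 f1 f0 p0 (ler0n _ _).
have {}K2 : `|rip (E (B D2 x)) (B D1 x) - rip (E0 (B D0 x)) (B D0 x)| <=
    (16 + 5 * 2 * C) * h * qnr D0 x ^+ 2.
  apply: K2.
  - exact: (four _ _ sa2 (gp_dom2 gp) (gp_near2 gp) b2 (qnr_B ipN sa2 Dx2)).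
  - exact: (four _ _ sa1 (gp_dom1 gp) (gp_near1 gp) b1 (qnr_B ipN sa1 Dx1)).
  - exact: qnr_B.
  - exact: (qnr_B_diff ipN sa2 sa0 (gp_dom2 gp) h0 h2 (gp_near2 gp) Dx).
  - exact: (qnr_B_diff ipN sa1 sa0 (gp_dom1 gp) h0 h2 (gp_near1 gp) Dx).
have {}K3 : `|rip (E (F D2 x)) (F D1 x) - rip (E0 (F D0 x)) (F D0 x)| <=
    (16 + 5 * 4 * C) * h * qnr D0 x ^+ 2.
  apply: K3.
  - exact: (four _ _ sa2 (gp_dom2 gp) (gp_near2 gp) f2 (qnr_F ipN sa2 Dx2)).
  - exact: (four _ _ sa1 (gp_dom1 gp) (gp_near1 gp) f1 (qnr_F ipN sa1 Dx1)).
  - exact: qnr_F.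
  - exact: (qnr_F_diff ipN sa2 sa0 (gp_dom2 gp) h0 h2 (gp_near2 gp) Dx).
  - exact: (qnr_F_diff ipN sa1 sa0 (gp_dom1 gp) h0 h2 (gp_near1 gp) Dx).
rewrite -hq /source.
move: c1 c2 K1 K2 K3 syl; rewrite !ler_norml.
move=> /andP[a1 a2] /andP[a3 a4] /andP[a5 a6] /andP[a7 a8] /andP[a9 a10] syl.
move: hX; rewrite -/X => hX; apply/andP; split; lra.
Qed.
End OnePair.

(** The source cancels between the two quotients, so their difference [X] satisfies a Lyapunov bound
    [c q]. *)
Lemma quot_close D1 D2 r D1' D2' r' :
  good_pair E0 K h D1 D2 r -> good_pair E0 K h D1' D2' r' ->
  forall x, nr (quot D1 D2 r x - quot D1' D2' r' x) <= (33 + 32 * K + 30 * C) * h * nr x.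
Proof.
move=> gp gp'; set c := (33 + 32 * K + 30 * C) * h.
have c0 : 0 <= c by rewrite /c mulr_ge0 // !addr_ge0 ?mulr_ge0.
pose X x := quot D1 D2 r x - quot D1' D2' r' x.
have lX : linear X.
  move=> a x y; rewrite /X (quot_linear _ (gp_sa1 gp) (gp_sa2 gp)) (quot_linear _ (gp_sa1 gp') (gp_sa2 gp')) scalerBr.
  by apply: (rip_ext ipN) => z; rewrite !ripE; ring.
have sX x y : rip (X x) y = rip x (X y).
  by rewrite /X ripBl ripBr (quot_sym _ (gp_sa1 gp) (gp_sa2 gp)) (quot_sym _ (gp_sa1 gp') (gp_sa2 gp')).
have DX x : dom D0 x -> dom D0 (X x).
  by move=> Dx; apply: domB; [exact: quot_dom gp _ _ | exact: quot_dom gp' _ _].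
have qX x : dom D0 x -> qform D0 (X x) (X x) <= 4 * (16 * K) ^+ 2 * qform D0 x x.
  move=> Dx; have d1 := quot_dom gp Dx; have d2 := quot_dom gp' Dx.
  apply: le_trans (qform_par sa0 d1 d2) _.
  rewrite -!(qnr_sq ipN sa0) //.
  have e : 0 <= 16 * K * qnr D0 x by rewrite !mulr_ge0 ?qnr_ge0.
  have := quot_qnr gp Dx; rewrite -(@ler_pXn2r _ 2) ?nnegrE ?qnr_ge0 // => k1.
  have := quot_qnr gp' Dx; rewrite -(@ler_pXn2r _ 2) ?nnegrE ?qnr_ge0 // => k2.
  move: k1 k2; rewrite !exprMn; lra.
have acc x : dom D0 x -> `|qform D0 x (X x)| <= c * qform D0 x x.
  move=> Dx; have := quot_sylvester gp Dx; have := quot_sylvester gp' Dx.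
  rewrite -/c {5}/qform /X ripBr -/(qform D0 x _) -/(qform D0 x _) !ler_norml.
  move=> /andP[a1 a2] /andP[a3 a4]; apply/andP; split; lra.
(* For [s = 1] and [s = -1], the bound [acc] says that [S0 A + A S0] is nonnegative as a form, with
   [A = c + s X]. *)
have pos (s : R) : `|s| = 1 -> forall x, dom D0 x -> 0 <= rip (c%:C *: x + s%:C *: X x) x.
  move=> s1 x Dx.
  apply: (@lyapunov _ _ ip ipN (dom D0) (qform D0) (fun x => c%:C *: x + s%:C *: X x)
    (2 * (c ^+ 2 + 4 * (16 * K) ^+ 2))) => //.
  - exact: dom_linset.
  - exact: qform_sym.
  - by move=> y; exact: qform_ge_nr.
  - by move=> y Dy; apply: dom_linset => //; apply: domZ; exact: DX.
  - by move=> y z _ _; rewrite ripDl ripDr !ripZl !ripZr sX.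
  - by have := sqr_ge0 c; have := sqr_ge0 (16 * K); lra.
  - move=> y Dy.
    have DXy := DX y Dy.
    have -> : c%:C *: y + s%:C *: X y = c%:C *: y - (- s)%:C *: X y.
      by rewrite rmorphN scaleNr opprK.
    apply: le_trans (qform_par sa0 (domZ _ Dy) (domZ _ DXy)) _.
    rewrite !(qformZ ipN sa0) // sqrrN -[s ^+ 2]real_normK ?num_real // s1 expr1n mul1r.
    by have := qX _ Dy; lra.
  - move=> y Dy; have DXy := DX y Dy.
    rewrite (qformC ipN sa0) //; last by apply: dom_linset => //; apply: domZ.
    rewrite /qform ripDr !ripZr -/(qform D0 y y) -/(qform D0 y (X y)).
    have := acc _ Dy; have := ler_norm (- (s * qform D0 y (X y))).
    by rewrite normrN normrM s1 mul1r; lra.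
have bX x : dom D0 x -> `|rip (X x) x| <= c * nr x ^+ 2.
  move=> Dx; have := pos 1 (normr1 _) _ Dx; have := pos (-1) _ _ Dx.
  rewrite normrN normr1 => /(_ erefl); rewrite [in X in X -> _]ripDl !ripZl => k1.
  rewrite ripDl !ripZl => k2; move: k1 k2; rewrite (ripnr ipN) ler_norml.
  by move=> k1 k2; apply/andP; split; lra.
apply: (dense_bound (W := dom D0) (L := 2 * `|r^-1| + 2 * `|r'^-1|) (G := X)) => //.
- exact: (sa_dense sa0).
- move=> x; apply: le_trans (nrD _ _) _; rewrite nrN mulrDl lerD //.
    exact: quot_nr (gp_sa1 gp) (gp_sa2 gp) _.
  exact: quot_nr (gp_sa1 gp') (gp_sa2 gp') _.
- move=> x Dx; have DXx := DX _ Dx; apply: (nr_le_rip ipN).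
    by rewrite mulr_ge0 ?nr_ge0.
  (* A symmetric operator is bounded in norm by its numerical radius: polarise and take
     [z = X x]. *)
  have := form_bound (e := fun x z => rip (X x) z) (q := rip) (@dom_linset _ _ D0)
    _ (rip_symform ip _) c0 _ _ Dx DXx.
  rewrite !(ripnr ipN) !sqrtr_sqr !ger0_norm ?nr_ge0 ?sqr_ge0 //; apply.
  + split=> [a u v w _ _ _|u v _ _]; last by rewrite sX ripC.
    by rewrite lX ripPl.
  + by move=> u _; rewrite (ripnr ipN) sqr_ge0.
  + by move=> u Du; rewrite (ripnr ipN); exact: bX.
Qed.
End Base.
End DifferenceQuotient.

(** * Continuity of the derivative as a form *)

Section DerivativeForm.
Variables (R : realType) (H : completeNormedModType R[i]).
Variables (ip : {dot H for Num.conj}).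
Hypothesis ipN : induces_norm ip.
Local Notation rip := (rip ip).
Local Notation qform := (qform ip).
Local Notation qnr := (qnr ip).

Lemma bform_diag D (E : H -> H) c : self_adjoint ip D -> 0 <= c ->
  (forall (a : R) x y, dom D x -> dom D y -> E (a%:C *: x + y) = a%:C *: E x + E y) ->
  (forall x y, dom D x -> dom D y -> rip (E x) y = rip x (E y)) ->
  (forall x, dom D x -> `|rip (E x) x| <= c * qform D x x) -> bform ip E D c.
Proof.
move=> D_sa c0 lE sE hE.
apply: (form_bound (e := fun x z => rip (E x) z) (W := dom D)) => //.
- exact: dom_linset.
- split=> [a u v w Du Dv Dw|u v Du Dv]; last by rewrite sE // ripC.
  by rewrite lE // ripPl.
- exact: qform_sym.
- by move=> u Du; exact: qform_ge0.
Qed.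

Variables D1 D0 : unbounded_op H.
Hypotheses (sa1 : self_adjoint ip D1) (sa0 : self_adjoint ip D0).
Hypothesis domE : dom D1 = dom D0.
Variable k : R.
Hypotheses (k0 : 0 <= k) (k2 : k <= 2^-1).
Hypothesis Vk : forall x, dom D0 x -> nr (D1 x - D0 x) <= k * nr (absq ip D0 x).
Local Notation S1 := (absq ip D1).
Local Notation S0 := (absq ip D0).
Local Notation B1 := (inv_sqrt_1sq ip D1).
Local Notation B0 := (inv_sqrt_1sq ip D0).
Variables (T1 T0 : H -> H) (C d : R).
Hypotheses (C0 : 0 <= C) (d0 : 0 <= d).
Hypothesis nT1 : forall y, nr (T1 y) <= C * nr y.
Hypothesis nT0 : forall y, nr (T0 y) <= C * nr y.
Hypothesis nT : forall y, nr (T1 y - T0 y) <= d * nr y.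
Local Notation E1 := (fun x => T1 (S1 x)).
Local Notation E0 := (fun x => T0 (S0 x)).
Hypothesis sE1 : forall x y, dom D1 x -> dom D1 y -> rip (E1 x) y = rip x (E1 y).
Hypothesis sE0 : forall x y, dom D0 x -> dom D0 y -> rip (E0 x) y = rip x (E0 y).

Let ratio x := absq_ratio ipN sa1 sa0 domE k0 Vk (x := x).

Let nr_S1B0 z : nr (S1 (B0 z)) <= 2 * nr z.
Proof.
have [h _] := ratio (dom_B ipN sa0 z); move: h; rewrite absq_B //.
have := ler_wpM2r (nr_ge0 z) k2; have := nr_ge0 z; lra.
Qed.

Let nr_S0B1 z : nr (S0 (B1 z)) <= 2 * nr z.
Proof.
have Db : dom D0 (B1 z) by rewrite -domE; exact: dom_B.
have [_ h] := ratio Db; move: h; rewrite absq_B //.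
have := ler_wpM2r (nr_ge0 (S0 (B1 z))) k2; have := nr_ge0 z; lra.
Qed.

(** Chosen so that [B1 P S1 = B1 E1 - B0 E0] on the domain. *)
Let P y := T1 y - S1 (B0 (T0 (S0 (B1 y)))).
Let K y := T1 (P y) - T0 (P y).

Let B1_P y : B1 (P y) = B1 (T1 y) - B0 (T0 (S0 (B1 y))).
Proof.
rewrite /P (linB (root_linear (inv_sqrt_spec ipN sa1))) B_absq //.
by rewrite domE; exact: dom_B.
Qed.

(** [5 = 1 + 2 * 2], a factor 2 for each of [S1 B0] and [S0 B1]. *)
Let P_nr y : nr (P y) <= 5 * C * nr y.
Proof.
apply: le_trans (nrD _ _) _; rewrite nrN.
have h1 := nr_S1B0 (T0 (S0 (B1 y))); have h2 := nT0 (S0 (B1 y)).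
have h3 := ler_wpM2l C0 (nr_S0B1 y); have := nT1 y; lra.
Qed.

(* The weighted form of the non-symmetric operator [T1 - T0] becomes symmetric
   after composition with P. *)
Let K_sym u v : rip (B1 u) (K v) = rip (B1 (P u)) (P v).
Proof.
have Db : dom D0 (B1 u) by rewrite -domE; exact: dom_B.
rewrite /K ripBr B1_P ripBl; congr (_ - _).
  have := sE1 (dom_B ipN sa1 u) (dom_B ipN sa1 (P v)); rewrite !absq_B // => <-.
  by rewrite -(root_sym (inv_sqrt_spec ipN sa1)).
have := sE0 Db (dom_B ipN sa0 (P v)); rewrite !(absq_B ipN sa0) => <-.
by rewrite -(root_sym (inv_sqrt_spec ipN sa0)).
Qed.

(** The form splits into [q1 x g], with [g = B1 (E1 x) - B0 (E0 x)], and the change from [q1] to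
    [q0] at [B0 (E0 x)]. Only [q1 g g] is of order [d], hence the square root. *)
Lemma derivative_form_close x : dom D0 x ->
  `|rip (E1 x - E0 x) x| <= (2 * Num.sqrt (5 * C * d) + k * C) * qform D0 x x.
Proof.
move=> Dx; have Dx1 : dom D1 x by rewrite domE.
have Br1 := inv_sqrt_spec ipN sa1; have Br0 := inv_sqrt_spec ipN sa0.
have c0 : 0 <= 5 * C * d by rewrite !mulr_ge0.
have kK := @Bform_krein_diag _ _ _ ipN _ sa1 K (5 * C * d) c0 _ _ (S1 x).
pose g := B1 (E1 x) - B0 (E0 x).
have Dg0 : dom D0 (B0 (E0 x)) := dom_B ipN sa0 _.
have Dg : dom D1 g by apply: domB; [exact: dom_B | rewrite domE].
have gP : B1 (P (S1 x)) = g by rewrite B1_P B_absq.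
(* With [y = S1 x], [K_sym] turns [q1 g g] into [rip (B1 y) (K y)], and [K] has norm at most
   [5 C d]. *)
have q1g : qform D1 g g <= 5 * C * d * qform D1 x x.
  have := kK _ _; rewrite K_sym gP B_absq // => {}kK.
  have -> : qform D1 g g = rip g (P (S1 x)).
    by rewrite /qform -gP absq_B // ripC.
  apply: le_trans (ler_norm _) _; rewrite /qform (ripC _ (S1 x)); apply: kK.
    by move=> u v; rewrite (root_sym Br1) ripC K_sym ripC -(root_sym Br1) -K_sym.
  move=> u; apply: le_trans (nT _) _.
  by have := ler_wpM2l d0 (P_nr u); lra.
have p1g : qnr D1 g <= Num.sqrt (5 * C * d) * qnr D1 x.
  by rewrite /qnr -sqrtrM //; exact: ler_wsqrtr.
have i1 : `|qform D1 x g| <= Num.sqrt (5 * C * d) * qform D1 x x.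
  apply: le_trans (qform_cs ipN sa1 Dx1 Dg) _; rewrite -(qnr_sq ipN sa1) // expr2.
  by rewrite mulrCA ler_wpM2l ?qnr_ge0.
have qr := qform_ratio ipN sa1 sa0 domE k0 k2 Vk Dx.
have q00 := qform_ge0 ipN sa0 Dx.
have q1q0 : qform D1 x x <= 2 * qform D0 x x.
  move: qr; rewrite ler_norml => /andP[_ h]; have := ler_wpM2r q00 k2; lra.
have {}i1 : `|qform D1 x g| <= 2 * Num.sqrt (5 * C * d) * qform D0 x x.
  apply: le_trans i1 _; have := ler_wpM2l (sqrtr_ge0 (5 * C * d)) q1q0; lra.
have i2 : `|qform D1 x (B0 (E0 x)) - qform D0 x (B0 (E0 x))| <= k * C * qform D0 x x.
  apply: le_trans (qform_cross ipN sa1 sa0 domE k0 k2 Vk Dx Dg0) _.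
  have := qnr_BE ipN sa0 C0 sE0 _ Dx => /(_ (fun u _ => nT0 _)) h.
  rewrite -(qnr_sq ipN sa0) // expr2 -!mulrA ler_wpM2l //.
  by rewrite [leRHS]mulrCA ler_wpM2l ?qnr_ge0.
have -> : rip (E1 x - E0 x) x = qform D1 x g + (qform D1 x (B0 (E0 x)) - qform D0 x (B0 (E0 x))).
  rewrite /qform /g ripBr -!(root_sym Br1) -!(root_sym Br0) (B_absq ipN sa1) //.
  rewrite (B_absq ipN sa0) // ripBl !(ripC _ x); ring.
by apply: le_trans (ler_normD _ _) _; rewrite mulrDl lerD.
Qed.
End DerivativeForm.

Section OperatorNorm.
Variables (R : realType) (H : completeNormedModType R[i]).

Lemma opnorm_ge0 (G : H -> H) : (0 <= opnorm G)%E.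
Proof.
apply: (@le_trans _ _ ((nr (G 0))%:E)); first by rewrite lee_fin nr_ge0.
by apply: ereal_sup_ubound; exists 0 => //=; rewrite normr0.
Qed.

Lemma opnorm_le (G : H -> H) (e : R) : 0 <= e -> (forall x, nr (G x) <= e * nr x) ->
  (opnorm G <= e%:E)%E.
Proof.
move=> e0 h; apply: ge_ereal_sup => _ [x /= hx <-]; rewrite lee_fin.
apply: le_trans (h x) _; move: hx; rewrite nrE (_ : 1 = (1 : R)%:C) // lecR.
by move=> /(ler_wpM2l e0); rewrite mulr1.
Qed.

Lemma opnorm_ub (G : H -> H) (e : R) :
  (forall (a : R) x, G (a%:C *: x) = a%:C *: G x) -> (opnorm G < e%:E)%E ->
  forall x, nr (G x) <= e * nr x.
Proof.
move=> hG hlt x.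
have [x0|n0] := eqVneq (nr x) 0.
  have -> : x = (0 : R)%:C *: x by rewrite (nr0_eq0 x0) scaler0.
  by rewrite hG !nrZ normr0 !mul0r mulr0.
have np : 0 < nr x by rewrite lt_def n0 nr_ge0.
pose y := (nr x)^-1%:C *: x.
have ny : nr y = 1 by rewrite nrZ gtr0_norm ?invr_gt0 // mulVf.
have : (((nr (G y))%:E) <= opnorm G)%E.
  by apply: ereal_sup_ubound; exists y => //=; rewrite nrE ny.
move=> /le_lt_trans /(_ hlt); rewrite lte_fin /y hG nrZ gtr0_norm ?invr_gt0 //.
by rewrite mulrC ltr_pdivrMr // => /ltW.
Qed.

Lemma near_dnbhs (I : set R) (t0 : R) (P : R -> Prop) :
  (\forall t \near within I t0^', P t) <->
  exists2 d, 0 < d & forall t, I t -> t != t0 -> `|t - t0| < d -> P t.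
Proof.
rewrite near_withinE /dnbhs; split.
  rewrite near_withinE => /nbhs_ballP [d d0 hd]; exists d => // t It tt0 htd.
  by apply: hd => //; rewrite /ball /= distrC.
move=> [d d0 hd]; rewrite near_withinE; apply/nbhs_ballP; exists d => // t.
by rewrite /ball /= distrC => h1 h2 h3; apply: hd.
Qed.

Lemma near_nbhs (I : set R) (t0 : R) (P : R -> Prop) :
  (\forall t \near within I (nbhs t0), P t) <->
  exists2 d, 0 < d & forall t, I t -> `|t - t0| < d -> P t.
Proof.
rewrite near_withinE; split.
  move=> /nbhs_ballP [d d0 hd]; exists d => // t It htd.
  by apply: hd => //; rewrite /ball /= distrC.
move=> [d d0 hd]; apply/nbhs_ballP; exists d => // t.
by rewrite /ball /= distrC => h1 h2; apply: hd.
Qed.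

Lemma cvge0_lt (F : set_system R) (f : R -> \bar R) (e : R) : Filter F -> 0 < e ->
  f t @[t --> F] --> 0%E -> \forall t \near F, (f t < e%:E)%E.
Proof.
move=> FF e0 h; apply: (h [set z | (z < e%:E)%E]).
exact: (@nbhs_open_ereal_lt R 0 (fun=> e)).
Qed.

Lemma cvge0_le (F : set_system R) (f : R -> \bar R) : Filter F ->
  (forall t, 0 <= f t)%E ->
  (forall e : R, 0 < e -> \forall t \near F, (f t <= e%:E)%E) ->
  f t @[t --> F] --> 0%E.
Proof.
move=> FF f0 h A hA.
have /nbhs_ballP [d d0 hd] : nbhs (0 : R) (fun r => A r%:E) by exact: hA.
have := h _ (divr_gt0 d0 (ltr0n R 2)); apply: filterS => t.
rewrite /preimage /mkset; have := f0 t; case: (f t) => // r; rewrite !lee_fin => r0 rd.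
have : ball (0 : R) d r -> A r%:E by exact: hd.
apply; rewrite /ball /= sub0r normrN ger0_norm //.
by apply: le_lt_trans rd _; rewrite ltr_pdivrMr // ltr_pMr // ltr1n.
Qed.

End OperatorNorm.

(** * Differentiable paths *)

Section GammaPath.
Variables (R : realType) (H : completeNormedModType R[i]).
Variables (ip : {dot H for Num.conj}).
Hypothesis ipN : induces_norm ip.
Local Notation rip := (rip ip).
Local Notation qform := (qform ip).
Variable D : R -> unbounded_op H.
Hypothesis D_sa : forall t : R, 0 <= t <= 1 -> self_adjoint ip (D t).
Hypothesis D_C1 : C1_Gamma_path ip D.
Local Notation I t := (0 <= t <= 1).
Local Notation B t := (inv_sqrt_1sq ip (D t)).
Local Notation S t := (absq ip (D t)).

Lemma I_itv (t : R) : (`[0, 1]%classic : set R) t = I t :> Prop.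
Proof. by rewrite /= in_itv. Qed.

Lemma I_near (t d : R) : I t -> 0 < d -> exists s, [/\ I s, s != t & `|s - t| < d].
Proof.
move=> /andP[t0 t1] d0; pose m := Num.min (d / 2) 2^-1.
have m0 : 0 < m by rewrite lt_min; apply/andP; split; lra.
have md : m < d by rewrite gt_min; apply/orP; left; lra.
have m2 : m <= 2^-1 by rewrite ge_min lexx orbT.
have [h|h] := leP t 2^-1.
  exists (t + m); split; first by apply/andP; split; lra.
    by rewrite -subr_eq0 addrAC subrr add0r gt_eqF.
  by rewrite addrAC subrr add0r gtr0_norm.
exists (t - m); split; first by apply/andP; split; lra.
  by rewrite -subr_eq0 addrAC subrr add0r oppr_eq0 gt_eqF.
by rewrite addrAC subrr add0r normrN gtr0_norm.
Qed.

Definition Gamma_op t : H -> H := get (is_Gamma_diff ip D t).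
Local Notation T := Gamma_op.
(** On the domain this is [Gamma_deriv], since there [sqrt_1sq] agrees with [absq]. *)
Definition deriv_op t x : H := T t (S t x).
Local Notation E := deriv_op.

Lemma Gamma_opP t : I t -> is_Gamma_diff ip D t (T t).
Proof.
by rewrite -I_itv => /D_C1.1 [T0 hT]; apply: getPex; exists T0.
Qed.

Lemma Gamma_op_linear t : I t -> linear (T t).
Proof. by move=> /Gamma_opP[[]]. Qed.

Lemma Gamma_op_bounded t : I t -> exists2 M, 0 <= M & forall x, nr (T t x) <= M * nr x.
Proof.
move=> /Gamma_opP[[_ [M hM]] _ _]; exists `|M| => // x.
have := hM x; rewrite !nrE -rmorphM lecR => h; apply: le_trans h _.
by rewrite ler_wpM2r ?nr_ge0 ?ler_norm.
Qed.

Lemma deriv_op_linear t (a : R) x y : I t -> dom (D t) x -> dom (D t) y ->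
  E t (a%:C *: x + y) = a%:C *: E t x + E t y.
Proof.
by move=> It Dx Dy; rewrite /E (absq_linear ipN (D_sa It)) // Gamma_op_linear.
Qed.

Lemma Gamma_diff_nr t (e : R) : I t -> 0 < e -> exists2 d, 0 < d &
  forall s, I s -> s != t -> `|s - t| < d -> dom (D t) `<=` dom (D s) /\
   forall x, dom (D t) x ->
     nr ((s - t)^-1%:C *: (D s x - D t x) - E t x) <= e * nr (S t x).
Proof.
move=> It e0; have [bT h1 h2] := Gamma_opP It.
have [d1 d10 {}h1] := (@near_dnbhs R _ _ _).1 h1.
have [d2 d20 {}h2] := (@near_dnbhs R _ _ _).1 (cvge0_lt _ e0 h2).
exists (Num.min d1 d2); first by rewrite lt_min d10.
move=> s; rewrite -I_itv lt_min => Is st /andP[sd1 sd2].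
have sub := h1 s Is st sd1; split=> // x Dx.
have := opnorm_ub _ (h2 s Is st sd2) (S t x); rewrite (B_absq ipN (D_sa It)) //; apply.
move=> a u /=; have Db := dom_B ipN (D_sa It) u.
have Dbs : dom (D s) (B t u) by apply: sub.
rewrite (linZ (root_linear (inv_sqrt_spec ipN (D_sa It)))) !appZ //.
rewrite (linZ (Gamma_op_linear It)).
by apply: (rip_ext ipN) => z; rewrite !(ripDl, ripNl, ripZl); ring.
Qed.

Lemma deriv_op_sym t x y : I t -> dom (D t) x -> dom (D t) y ->
  rip (E t x) y = rip x (E t y).
Proof.
move=> It Dx Dy.
apply: (@eqr_scaled _ _ _ (nr (S t x) * nr y + nr x * nr (S t y))) => e e0.
have [d d0 hd] := Gamma_diff_nr It e0.
have [s [Is st sd]] := I_near It d0.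
have [sub {}hd] := hd s Is st sd.
pose Q z := (s - t)^-1%:C *: (D s z - D t z).
have sQ : rip (Q x) y = rip x (Q y).
  rewrite /Q ripZl ripZr ripBl ripBr (sa_sym (D_sa It)) // (sa_sym (D_sa Is)) //.
  - exact: sub.
  - exact: sub.
have -> : rip (E t x) y - rip x (E t y) = rip x (Q y - E t y) - rip (Q x - E t x) y.
  by rewrite ripBl ripBr sQ; ring.
have h1 := le_trans (rip_le ipN x (Q y - E t y)) (ler_wpM2l (nr_ge0 x) (hd y Dy)).
have h2 := le_trans (rip_le ipN (Q x - E t x) y) (ler_wpM2r (nr_ge0 y) (hd x Dx)).
by apply: le_trans (ler_normB _ _) _; lra.
Qed.

Lemma Gamma_op_continuous t (e : R) : I t -> 0 < e -> exists2 d, 0 < d &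
  forall s, I s -> `|s - t| < d -> forall y, nr (T s y - T t y) <= e * nr y.
Proof.
move=> It e0; have := D_C1.2 t; rewrite I_itv => /(_ It) h.
have [d d0 {}h] := (@near_nbhs R _ _ _).1 (cvge0_lt _ e0 h).
exists d => // s Is sd y.
have Is' : (`[0, 1]%classic : set R) s by rewrite I_itv.
have := opnorm_ub _ (h s Is' sd) y.
rewrite /Gamma_deriv /= !(sqrt_1sq_B ipN (D_sa _)) //; apply => a x.
rewrite !(sqrt_1sq_B ipN (D_sa _)) //.
rewrite -/(T t) -/(T s) (linZ (Gamma_op_linear It)) (linZ (Gamma_op_linear Is)).
by rewrite scalerBr.
Qed.

Lemma D_near t (e : R) : I t -> 0 < e -> exists2 d, 0 < d &
  forall s, I s -> `|s - t| < d -> dom (D s) = dom (D t) /\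
    forall x, dom (D t) x -> nr (D s x - D t x) <= e * nr (S t x).
Proof.
move=> It e0; have [M M0 hM] := Gamma_op_bounded It.
have [d1 d10 h1] := Gamma_diff_nr It ltr01.
(* Keeps the relative bound below 1, as [dom_perturbed] requires. *)
pose e' := Num.min e 2^-1.
have e'0 : 0 < e' by rewrite lt_min e0 invr_gt0 ltr0n.
have c0 : 0 < M + 1 by rewrite ltr_wpDl.
exists (Num.min d1 (e' / (M + 1))).
  by rewrite lt_min d10 divr_gt0.
move=> s Is; rewrite lt_min => /andP[sd1 sd2].
have [->|st] := eqVneq s t.
  by split=> // x Dx; rewrite subrr nr0 mulr_ge0 ?nr_ge0 ?ltW.
have [sub {}h1] := h1 s Is st sd1.
have key x : dom (D t) x -> nr (D s x - D t x) <= e' * nr (S t x).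
  move=> Dx; have r0 : s - t != 0 by rewrite subr_eq0.
  have -> : D s x - D t x = (s - t)%:C *: ((s - t)^-1%:C *: (D s x - D t x)).
    by rewrite scalerA -rmorphM /= mulfV // scale1r.
  rewrite nrZ; set u := _^-1%:C *: _.
  have hu : nr u <= (M + 1) * nr (S t x).
    have := nr_tri u (E t x) 0; rewrite !subr0.
    have := h1 x Dx; have := hM (S t x); rewrite /E -/u; lra.
  apply: le_trans (ler_wpM2l (normr_ge0 _) hu) _; rewrite mulrA ler_wpM2r ?nr_ge0 //.
  by rewrite -ler_pdivlMr // ltW.
split; last first.
  by move=> x Dx; apply: le_trans (key x Dx) _; rewrite ler_wpM2r ?nr_ge0 // ge_min lexx.
apply: (dom_perturbed ipN (D_sa Is) (D_sa It) sub (ltW e'0) _ key).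
by rewrite gt_min invf_lt1 ?ltr1n ?orbT.
Qed.

Lemma deriv_op_near t (e : R) : I t -> 0 < e -> exists2 d, 0 < d &
  forall s, I s -> `|s - t| < d -> bform ip (fun x => E s x - E t x) (D t) e.
Proof.
move=> It e0; have [M M0 hM] := Gamma_op_bounded It.
pose C := M + 1; have C0 : 0 < C by rewrite /C ltr_wpDl.
(* [k] and [d] make each of the two terms of [derivative_form_close] at most [e / 2]. *)
pose k := Num.min 2^-1 (e / (2 * C)).
have k0 : 0 < k by rewrite lt_min invr_gt0 ltr0n divr_gt0 ?mulr_gt0.
pose d := Num.min 1 ((e / 4) ^+ 2 / (5 * C)).
have d0 : 0 < d by rewrite lt_min ltr01 divr_gt0 ?exprn_gt0 ?mulr_gt0 ?divr_gt0.
have [r1 r10 h1] := D_near It k0; have [r2 r20 h2] := Gamma_op_continuous It d0.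
exists (Num.min r1 r2); first by rewrite lt_min r10.
move=> s Is; rewrite lt_min => /andP[sr1 sr2].
have [domE Vk] := h1 s Is sr1; have {}h2 := h2 s Is sr2.
have nTt y : nr (T t y) <= C * nr y.
  by apply: le_trans (hM y) _; rewrite ler_wpM2r ?nr_ge0 // lerDl.
have nTs y : nr (T s y) <= C * nr y.
  have := nr_tri (T s y) (T t y) 0; rewrite !subr0; have := hM y; have := h2 y.
  have d1 : d <= 1 by rewrite ge_min lexx.
  by have := ler_wpM2r (nr_ge0 y) d1; rewrite /C; lra.
have sub x : dom (D t) x -> dom (D s) x by rewrite domE.
have k2 : k <= 2^-1 by rewrite ge_min lexx.
apply: (bform_diag ipN (D_sa It)) => //; first exact: ltW.
- move=> a x y Dx Dy; rewrite !deriv_op_linear //; try exact: sub.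
  by apply: (rip_ext ipN) => z; rewrite !ripE; ring.
- move=> x y Dx Dy; rewrite ripBl ripBr (deriv_op_sym It) // (deriv_op_sym Is) //.
  + exact: sub.
  + exact: sub.
move=> x Dx.
have := derivative_form_close ipN (D_sa Is) (D_sa It) domE (ltW k0) k2 Vk
  (ltW C0) (ltW d0) nTs nTt h2 _ _ Dx.
have q0 := qform_ge0 ipN (D_sa It) Dx.
move=> h; apply: le_trans (h _ _) _.
- by move=> u v Du Dv; apply: deriv_op_sym.
- by move=> u v Du Dv; apply: deriv_op_sym.
rewrite ler_wpM2r //.
have s1 : Num.sqrt (5 * C * d) <= e / 4.
  have e4 : e / 4 = Num.sqrt ((e / 4) ^+ 2) by rewrite sqrtr_sqr ger0_norm // divr_ge0 ?ltW.
  rewrite e4; apply: ler_wsqrtr.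
  have hd : d <= (e / 4) ^+ 2 / (5 * C) by rewrite ge_min lexx orbT.
  by rewrite mulrC -ler_pdivlMr // mulr_gt0.
have s2 : k * C <= e / 2.
  have hk : k <= e / (2 * C) by rewrite ge_min lexx orbT.
  apply: le_trans (ler_wpM2r (ltW C0) hk) _.
  by rewrite invfM mulrA divfK // gt_eqF.
lra.
Qed.

End GammaPath.

(** * Existence and continuity of the derivative of the bounded transform *)

Section ContinuousDerivative.
Variables (R : realType) (H : completeNormedModType R[i]).
Variables (ip : {dot H for Num.conj}).
Hypothesis ipN : induces_norm ip.
Local Notation rip := (rip ip).
Local Notation qform := (qform ip).
Variable D : R -> unbounded_op H.
Hypothesis D_sa : forall t : R, 0 <= t <= 1 -> self_adjoint ip (D t).
Hypothesis D_C1 : C1_Gamma_path ip D.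
Local Notation I t := (0 <= t <= 1).
Local Notation S t := (absq ip (D t)).
Local Notation E := (deriv_op ip D).
Local Notation T := (Gamma_op ip D).
Local Notation Q s t := (quot ip (D s) (D t) (s - t)).

(** In [K = M + 2], [M] bounds the operator at [t0], one unit covers its change up to [t], and one
    the error of the quotient at [t]. *)
Lemma good_pairs t0 : I t0 -> exists K C, [/\ 0 <= K, 0 <= C, bform ip (E t0) (D t0) C &
  forall h, 0 < h -> exists2 d, 0 < d & forall t, I t -> `|t - t0| < d ->
    exists2 d', 0 < d' & forall s, I s -> s != t -> `|s - t| < d' ->
      good_pair ip (D t0) (E t0) K h (D s) (D t) (s - t)].
Proof.
move=> It0; have sa0 := D_sa It0.
have [M M0 hM] := Gamma_op_bounded D_C1 It0.
exists (M + 2), M; split=> //; first by rewrite addr_ge0.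
  apply: (bform_diag ipN sa0 M0).
  - by move=> a x y; exact: deriv_op_linear.
  - by move=> x y; exact: deriv_op_sym.
  - apply: (qform_bound ipN sa0 M0) => [x y|x _]; first exact: deriv_op_sym.
    exact: hM.
move=> h h0; pose h' := Num.min h 2^-1.
have h'0 : 0 < h' by rewrite lt_min h0 invr_gt0 ltr0n.
have h'h : h' <= h by rewrite ge_min lexx.
have h'2 : h' <= 2^-1 by rewrite ge_min lexx orbT.
have [d1 d10 n1] := D_near ipN D_sa D_C1 It0 h'0.
have [d2 d20 n2] := Gamma_op_continuous ipN D_sa D_C1 It0 ltr01.
have hh0 : 0 < h / 2 by rewrite divr_gt0.
have [d3 d30 n3] := deriv_op_near ipN D_sa D_C1 It0 hh0.
(* The halves of [d1] keep both [t] and [s] within [d1] of [t0]. *)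
exists (Num.min (d1 / 2) (Num.min d2 d3)); first by rewrite !lt_min !divr_gt0 ?d20.
move=> t It; rewrite !lt_min => /and3P[td1 td2 td3].
have [|domt Vt] := n1 t It; first by move: td1; lra.
have {}n2 := n2 t It td2; have {}n3 := n3 t It td3; have sat := D_sa It.
(* The bound 1 enters [K]. The bound [h / 4] becomes [h / 2] when the form at [t] is compared with
   the one at [t0]; [n3] supplies the other half. *)
have e0 : 0 < Num.min 1 (h / 4) by rewrite lt_min ltr01 divr_gt0.
have [d4 d40 n4] := Gamma_diff_nr ipN D_sa D_C1 It e0.
have K0 : 0 < M + 2 by rewrite ltr_wpDl.
pose d5 := (2 * (M + 2))^-1; have d50 : 0 < d5 by rewrite invr_gt0 mulr_gt0.
exists (Num.min (d1 / 2) (Num.min d4 d5)); first by rewrite !lt_min !divr_gt0 ?d40.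
move=> s Is st; rewrite !lt_min => /and3P[sd1 sd4 sd5].
have [|doms Vs] := n1 s Is.
  have -> : s - t0 = (s - t) + (t - t0) by ring.
  by apply: le_lt_trans (ler_normD _ _) _; lra.
have sas := D_sa Is; have r0 : s - t != 0 by rewrite subr_eq0.
have [sub {}n4] := n4 s Is st sd4.
pose q x := (s - t)^-1%:C *: (D s x - D t x).
have hE x : nr (E t x) <= (M + 1) * nr (S t x).
  have := nr_tri (E t x) (T t0 (S t x)) 0; rewrite !subr0.
  have := n2 (S t x); have := hM (S t x); rewrite /E; lra.
have nS x := nr_ge0 (S t x).
have m1 : Num.min 1 (h / 4) <= 1 by rewrite ge_min lexx.
have m2 : Num.min 1 (h / 4) <= h / 4 by rewrite ge_min lexx orbT.
split=> //.
- by rewrite mulrC -ler_pdivlMr // -invfM ltW.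
- by move=> x Dx; apply: le_trans (Vs x Dx) _; rewrite ler_wpM2r ?nr_ge0.
- by move=> x Dx; apply: le_trans (Vt x Dx) _; rewrite ler_wpM2r ?nr_ge0.
- move=> x Dx; have -> : D s x - D t x = (s - t)%:C *: q x.
    by rewrite /q scalerA -rmorphM /= mulfV // scale1r.
  rewrite nrZ [(M + 2) * _]mulrC -mulrA ler_wpM2l //.
  have := nr_tri (q x) (E t x) 0; rewrite !subr0.
  have := n4 x Dx; have := hE x; have := ler_wpM2r (nS x) m1; rewrite -/(q x); lra.
have domst x : dom (D t0) x -> dom (D s) x /\ dom (D t) x by rewrite doms domt.
apply: (bform_diag ipN sa0 (ltW h0)).
- move=> a x y Dx Dy; have [sx tx] := domst x Dx; have [sy ty] := domst y Dy.
  rewrite (deriv_op_linear ipN D_sa) // !app_linear //.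
  by apply: (rip_ext ipN) => z; rewrite !(ripDl, ripNl, ripZl); ring.
- move=> x y Dx Dy; have [sx tx] := domst x Dx; have [sy ty] := domst y Dy.
  rewrite ripBl ripBr ripZl ripZr ripBl ripBr (sa_sym sat tx) // (sa_sym sas sx) //.
  by rewrite (deriv_op_sym ipN D_sa D_C1 It0).
move=> x Dx; have [sx tx] := domst x Dx.
have k1 : `|rip (q x - E t x) x| <= h / 4 * qform (D t) x x.
  apply: (qform_bound (E := fun x => q x - E t x) ipN sat _ _ _ tx); first by rewrite divr_ge0 ?ltW.
  - move=> u v tu tv; rewrite ripBl ripBr (deriv_op_sym ipN D_sa D_C1 It) //.
    rewrite /q ripZl ripZr ripBl ripBr (sa_sym sat tu) // (sa_sym sas (sub _ tu)) //.
    exact: sub.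
  - move=> u tu; apply: le_trans (n4 u tu) _; exact: ler_wpM2r.
have q00 := qform_ge0 ipN sa0 Dx.
have k2 : qform (D t) x x <= 2 * qform (D t0) x x.
  have := qform_ratio ipN sat sa0 domt (ltW h'0) h'2 Vt Dx.
  by rewrite ler_norml => /andP[_ l]; have := ler_wpM2r q00 h'2; lra.
have k3 : `|rip (E t x - E t0 x) x| <= h / 2 * qform (D t0) x x.
  by have := n3 x x Dx Dx; rewrite -mulrA -expr2 (qnr_sq ipN).
have -> : rip ((s - t)^-1%:C *: (D s x - D t x) - E t0 x) x =
    rip (q x - E t x) x + rip (E t x - E t0 x) x by rewrite !ripBl; ring.
apply: le_trans (ler_normD _ _) _.
have h4 : 0 <= h / 4 by rewrite divr_ge0 ?ltW.
have := ler_wpM2l h4 k2; lra.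
Qed.

(** Taking [t1 = t2] gives the Cauchy property of the quotients at one point, and [t2 = t0] the
    continuity of their limit. *)
Lemma quot_close_near t0 e : I t0 -> 0 < e -> exists2 d, 0 < d &
  forall t1 t2, I t1 -> I t2 -> `|t1 - t0| < d -> `|t2 - t0| < d ->
    exists2 d', 0 < d' & forall s1 s2, I s1 -> I s2 -> s1 != t1 -> s2 != t2 ->
      `|s1 - t1| < d' -> `|s2 - t2| < d' ->
      forall x, nr (Q s1 t1 x - Q s2 t2 x) <= e * nr x.
Proof.
move=> It0 e0; have [K [C [K0 C0 EC gp]]] := good_pairs It0.
pose c := 33 + 32 * K + 30 * C.
have c0 : 0 < c by rewrite /c; lra.
pose h := Num.min 2^-1 (e / c).
have h0 : 0 < h by rewrite lt_min invr_gt0 ltr0n divr_gt0.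
have h2 : h <= 2^-1 by rewrite ge_min lexx.
have [d d0 hd] := gp h h0; exists d => // t1 t2 I1 I2 td1 td2.
have [d1 d10 h1] := hd t1 I1 td1; have [d2 d20 {}h2'] := hd t2 I2 td2.
exists (Num.min d1 d2); first by rewrite lt_min d10.
move=> s1 s2 Is1 Is2 st1 st2; rewrite !lt_min => /andP[sd1 _] /andP[_ sd2] x.
have EB u v : dom (D t0) u -> dom (D t0) v -> E t0 (u - v) = E t0 u - E t0 v.
  move=> Du Dv; rewrite /E (absqB ipN (D_sa It0)) //.
  by rewrite (linB (Gamma_op_linear D_C1 It0)).
apply: le_trans (quot_close ipN (D_sa It0) K0 (ltW h0) h2 C0 EB EC
  (h1 s1 Is1 st1 sd1) (h2' s2 Is2 st2 sd2) x) _.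
rewrite ler_wpM2r ?nr_ge0 // -/c mulrC -ler_pdivlMr //.
by rewrite ge_min lexx orbT.
Qed.

Lemma quot_limit t : I t -> exists G : H -> H, bounded_op G /\
  forall e, 0 < e -> exists2 d, 0 < d & forall s, I s -> s != t -> `|s - t| < d ->
    forall x, nr (Q s t x - G x) <= e * nr x.
Proof.
move=> It.
have cau e : 0 < e -> exists2 d, 0 < d & forall s s', I s -> I s' -> s != t -> s' != t ->
    `|s - t| < d -> `|s' - t| < d -> forall x, nr (Q s t x - Q s' t x) <= e * nr x.
  move=> e0; have [d d0 hd] := quot_close_near It e0.
  by have [| |d' d'0 hd'] := hd t t It It; rewrite ?subrr ?normr0 //; exists d'.
have ex (n : nat) : exists s, [/\ I s, s != t & `|s - t| < n.+1%:R^-1].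
  by apply: I_near => //; rewrite invr_gt0.
have [u hu] := choice ex.
have uN d : 0 < d -> exists N, forall n, (N <= n)%N -> `|u n - t| < d.
  move=> d0; have [N hN] := inv_natS_lt d0; exists N => n Nn.
  by have [_ _ h] := hu n; apply: lt_trans h (hN n Nn).
have lim x : exists l, forall e : R, 0 < e -> exists N, forall n, (N <= n)%N -> nr (Q (u n) t x - l) < e.
  apply: nr_cauchy => e e0; have x0 : 0 < nr x + 1 by rewrite ltr_wpDl ?nr_ge0.
  have [d d0 hd] := cau _ (divr_gt0 e0 x0); have [N hN] := uN d d0.
  exists N => m n Nm Nn; have [Im tm _] := hu m; have [In tn _] := hu n.
  apply: le_lt_trans (hd _ _ Im In tm tn (hN m Nm) (hN n Nn) x) _.
  by rewrite mulrAC ltr_pdivrMr // ltr_pM2l // ltrDl.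
have [G hG] := choice lim.
have unif e : 0 < e -> exists2 d, 0 < d & forall s, I s -> s != t -> `|s - t| < d ->
    forall x, nr (Q s t x - G x) <= e * nr x.
  move=> e0; have [d d0 hd] := cau e e0; exists d => // s Is st sd x.
  apply/ler_addgt0Pl => e' e'0; have [N1 h1] := hG x e' e'0; have [N2 h2] := uN d d0.
  pose n := maxn N1 N2; have [In tn _] := hu n.
  apply: le_trans (nr_tri _ (Q (u n) t x) _) _; rewrite addrC lerD //.
    by rewrite ltW // h1 // leq_maxl.
  by apply: hd => //; apply: h2; rewrite leq_maxr.
have near e : 0 < e -> exists s, [/\ I s, s != t & forall x, nr (Q s t x - G x) <= e * nr x].
  move=> e0; have [d d0 hd] := unif e e0; have [s [Is st sd]] := I_near It d0.
  by exists s; split=> //; apply: hd.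
exists G; split=> //.
(* A single quotient at distance at most 1 from [G] already bounds it. *)
have [s1 [Is1 st1 h1]] := near 1 ltr01.
apply: (@bounded_real _ _ _ (2 * `|(s1 - t)^-1| + 1)).
  move=> a x y.
  apply: (@eq_scaled _ _ _ _ (nr (a *: x + y) + (complex.Re `|a| * nr x + nr y))) => e e0.
  have [s [Is st hs]] := near e e0.
  have -> : G (a *: x + y) - (a *: G x + G y) =
     - (Q s t (a *: x + y) - G (a *: x + y)) + (a *: (Q s t x - G x) + (Q s t y - G y)).
    rewrite (quot_linear ipN _ (D_sa Is) (D_sa It)) scalerBr; move: (Q s t x) (Q s t y) => v w.
    by apply: (rip_ext ipN) => z; rewrite !ripE; ring.
  apply: le_trans (nrD _ _) _; rewrite mulrDr nrN lerD ?hs //.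
  apply: le_trans (nrD _ _) _; rewrite mulrDr nrZc mulrCA lerD ?hs // ler_wpM2l ?hs //.
  by have := normr_ge0 a; rewrite normc_def lecR.
move=> x; have := nr_tri (G x) (Q s1 t x) 0; rewrite !subr0 (nrB (G x)).
have := h1 x; have := quot_nr ipN (s1 - t) (D_sa Is1) (D_sa It) x; lra.
Qed.

End ContinuousDerivative.

Theorem theorem22 (R : realType) (H : completeNormedModType R[i])
    (ip : {dot H for Num.conj}) (ipN : induces_norm ip)
    (D : R -> unbounded_op H)
    (D_sa : forall t : R, 0 <= t <= 1 -> self_adjoint ip (D t))
    (D_C1 : C1_Gamma_path ip D) :
  norm_C1_path (fun t : R => vartheta ip (D t)).
Proof.
have ex t : exists G : H -> H, 0 <= t <= 1 -> bounded_op G /\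
  forall e, 0 < e -> exists2 d, 0 < d & forall s, 0 <= s <= 1 -> s != t -> `|s - t| < d ->
    forall x, nr (quot ip (D s) (D t) (s - t) x - G x) <= e * nr x.
  (* Outside the interval [id] is a placeholder that makes [F'] total. *)
  have [It|nIt] := boolP (0 <= t <= 1); last by exists id.
  by have [G hG] := quot_limit ipN D_sa D_C1 It; exists G.
have [F' hF'] := choice ex.
split.
  move=> t; rewrite I_itv => It; apply: (@bounded_real _ _ _ 1).
    exact: F_linear (D_sa t It).
  by move=> x; rewrite mul1r; exact: nr_F (D_sa t It) x.
exists F'; split.
- by move=> t; rewrite I_itv => /hF'[].
- move=> t; rewrite I_itv => It; have [_ h] := hF' t It.
  apply: cvge0_le => [s|e e0]; first exact: opnorm_ge0.
  apply/(@near_dnbhs R); have [d d0 hd] := h e e0; exists d => // s.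
  rewrite I_itv => Is st sd; apply: opnorm_le; first exact: ltW.
  exact: hd.
- move=> t0; rewrite I_itv => It0.
  apply: cvge0_le => [s|e e0]; first exact: opnorm_ge0.
  apply/(@near_nbhs R).
  (* One third each for [F' t] against a quotient at [t], that quotient against one at [t0], and the
     latter against [F' t0]. *)
  have e3 : 0 < e / 3 by rewrite divr_gt0.
  have [d d0 hd] := quot_close_near ipN D_sa D_C1 It0 e3.
  exists d => // t; rewrite I_itv => It td; apply: opnorm_le; first exact: ltW.
  have [|d' d'0 {}hd] := hd t t0 It It0 td; first by rewrite subrr normr0.
  have [_ /(_ _ e3)[d1 d10 h1]] := hF' t It.
  have [_ /(_ _ e3)[d2 d20 h2]] := hF' t0 It0.
  have m1 : 0 < Num.min d' d1 by rewrite lt_min d'0.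
  have m2 : 0 < Num.min d' d2 by rewrite lt_min d'0.
  have [s1 [Is1 st1]] := I_near It m1; rewrite lt_min => /andP[sd1 sd1'].
  have [s2 [Is2 st2]] := I_near It0 m2; rewrite lt_min => /andP[sd2 sd2'].
  move=> x; have k1 := h1 s1 Is1 st1 sd1' x; have k2 := h2 s2 Is2 st2 sd2' x.
  have k3 := hd s1 s2 Is1 Is2 st1 st2 sd1 sd2 x.
  move: k1 k2 k3; set u := quot _ _ _ _ _; set v := quot _ _ _ _ _ => k1 k2 k3.
  have := nr_tri (F' t x) u (F' t0 x); have := nr_tri u v (F' t0 x).
  rewrite (nrB (F' t x) u); lra.
Qed.
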